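(* Let $\Lambda = (\lambda_n)_{n \ge 1}$ be a sequence with $0 < \lambda_n < 1/2$ for every $n \ge 1$, such that $\sum_{n=1}^{\infty} |\lambda_n - \lambda_{n+1}| < \infty$. Let $E(\Lambda) \subset \mathbb{C}$ be the associated planar Cantor set, $\mu$ its intrinsic probability measure, $\sigma_0 = 1$ and $\sigma_n = \lambda_1 \cdots \lambda_n$ for $n \ge 1$. If the sequence $(4^n \sigma_n)_{n \in \mathbb{N}}$ is nondecreasing and $$\lim_{n \to \infty} 4^n \sigma_n = \infty,$$ then there exists $a \in E(\Lambda)$ such that the Cauchy integral $C(\mu)$ has a principal value at $a$. Equivalently, there exists a Lebesgue point of $C(\mu)$ in $E(\Lambda)$.
   Context: Here $\mathbb{N} = \{0, 1, 2, \dots\}$ and $\mathbb{R}^2$ is identified with $\mathbb{C}$. Cantor set: start with the square $S_0 = [0,1]^2$. Inside $S_0$ take the $4$ squares of side length $\lambda_1$, with sides parallel to the coordinate axes, each contained in $S_0$ and containing a vertex of $S_0$. Repeat the operation in each of these squares with compression factor $\lambda_2$, and so on inductively. At generation $n$ one gets $4^n$ (closed) squares $S_{n,\alpha}$, $\alpha \in \{1, \dots, 4^n\}$, of side length $\sigma_n = \lambda_1 \cdots \lambda_n$. Then $E(\Lambda) = \bigcap_{n=1}^\infty \bigcup_{\alpha=1}^{4^n} S_{n,\alpha}$. The intrinsic probability measure $\mu$ on $E(\Lambda)$ is the Borel probability measure supported on $E(\Lambda)$ with $\mu(S_{n,\alpha}) = 1/4^n$ for every $n$ and $\alpha$. The Cauchy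 integral of $\mu$ is $C(\mu)(z) = \int_{\mathbb{C}} \frac{\mathrm{d}\mu(w)}{z-w}$ for almost every $z \in \mathbb{C}$. It has a principal value at $a$ if the limit $\lim_{\epsilon \to 0} \int_{\mathbb{C} \setminus B_\epsilon(a)} \frac{\mathrm{d}\mu(w)}{a-w}$ exists in $\mathbb{C}$, where $B_\epsilon(a)$ is the disc of radius $\epsilon$ centered at $a$. A point $a$ is a Lebesgue point of $C(\mu)$ if there exists $\alpha \in \mathbb{C}$ such that $\lim_{r \to 0} \frac{1}{|B_r(a)|}\int_{B_r(a)} |C(\mu) - \alpha| = 0$ (with respect to two-dimensional Lebesgue measure). *)

(* Defs.v *)
From HB Require Import structures.
From mathcomp Require Import all_boot all_order all_algebra.
From mathcomp Require Import all_classical all_reals all_analysis.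
From mathcomp Require Import complex.

Set Implicit Arguments.
Unset Strict Implicit.
Unset Printing Implicit Defensive.

Import Order.TTheory GRing.Theory Num.Theory numFieldNormedType.Exports.

Local Open Scope classical_set_scope.
Local Open Scope complex_scope.
Local Open Scope ring_scope.

(* [measurableTypeR R] is [R] with its Borel sigma-algebra, so the product
   sigma-algebra on [plane R] is the Borel one; complex-valued functions take
   their values in [R[i]], to which points are sent by [toC]. *)
Notation plane R := (measurableTypeR R * measurableTypeR R)%type.

Definition toC (R : realType) (z : plane R) : R[i] := (z.1 : R) +i* (z.2 : R).

Definition cmod (R : realType) (z : R[i]) : R := ComplexField.Normc.normc z.

Definition disc (R : realType) (a : plane R) (r : R) : set (plane R) :=
  [set z | cmod (toC z - toC a) < r].

Definition lebesgue_plane (R : realType) :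
    {measure set (plane R) -> \bar R} :=
  (@lebesgue_measure R \x @lebesgue_measure R)%E.

Definition cintegral (R : realType) (mu : {measure set (plane R) -> \bar R})
    (D : set (plane R)) (f : plane R -> R[i]) : R[i] :=
  (\int[mu]_(w in D) complex.Re (f w)) +i* (\int[mu]_(w in D) complex.Im (f w)).

(* Squares are given by their lower left corner and their side length. *)
Definition square (R : realType) (Q : R * R * R) : set (plane R) :=
  [set z | (Q.1.1 <= (z.1 : R) <= Q.1.1 + Q.2) /\
           (Q.1.2 <= (z.2 : R) <= Q.1.2 + Q.2)].

(* The subsquare of [Q] of side length [l * Q.2] containing the vertex [v]
   of [Q]; e.g. [(false, true)] is the upper left vertex. *)
Definition subsquare (R : realType) (l : R) (v : bool * bool)
    (Q : R * R * R) : R * R * R :=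
  ((Q.1.1 + v.1%:R * (Q.2 - l * Q.2), Q.1.2 + v.2%:R * (Q.2 - l * Q.2)),
   l * Q.2).

(* [lam n] is relevant for [n >= 1] only.  The 4^n squares of generation [n]
   are indexed by the words of length [n] in the vertices, the last chosen
   vertex being the head of the word. *)
Fixpoint cantor_square (R : realType) (lam : nat -> R)
    (w : seq (bool * bool)) : R * R * R :=
  if w is v :: w' then subsquare (lam (size w)) v (cantor_square lam w')
  else ((0, 0), 1).

Definition cantor_set (R : realType) (lam : nat -> R) : set (plane R) :=
  \bigcap_(n in [set n | (1 <= n)%N])
    \bigcup_(w in [set w | size w = n]) square (cantor_square lam w).

Definition sigma (R : realType) (lam : nat -> R) (n : nat) : R :=
  \prod_(1 <= k < n.+1) lam k.

Definition is_intrinsic_measure (R : realType) (lam : nat -> R)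
    (mu : probability (plane R) R) : Prop :=
  mu (~` cantor_set lam) = 0%E /\
  forall w : seq (bool * bool),
    mu (square (cantor_square lam w)) = ((4 ^+ size w)^-1)%:E.

(* Meaningful for almost every [z] only: elsewhere the integrand need not be
   integrable. *)
Definition cauchy_integral (R : realType)
    (mu : {measure set (plane R) -> \bar R}) (z : plane R) : R[i] :=
  cintegral mu setT (fun w => (toC z - toC w)^-1).

Definition truncated_cauchy (R : realType)
    (mu : {measure set (plane R) -> \bar R}) (a : plane R) (e : R) : R[i] :=
  cintegral mu (~` disc a e) (fun w => (toC a - toC w)^-1).

(* The topology on [R[i]] is found through the alias [R[i]^o]. *)
Definition has_principal_value (R : realType)
    (mu : {measure set (plane R) -> \bar R}) (a : plane R) : Prop :=
  exists l : R[i]^o,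
    (truncated_cauchy mu a e : R[i]^o) @[e --> (0 : R)^'+] --> l.

Definition is_lebesgue_point (R : realType) (f : plane R -> R[i])
    (a : plane R) : Prop :=
  exists alpha : R[i],
    ((lebesgue_plane R (disc a r))^-1 *
       \int[lebesgue_plane R]_(z in disc a r) (cmod (f z - alpha))%:E)%E
      @[r --> (0 : R)^'+] --> 0%E.

(* Main.v *)
From HB Require Import structures.
Require Import Defs.
From mathcomp Require Import all_boot all_order all_algebra.
From mathcomp Require Import all_classical all_reals all_analysis.
From mathcomp Require Import complex measurable_realfun.
From mathcomp Require Import zify ring lra.
Import Order.TTheory GRing.Theory Num.Theory numFieldNormedType.Exports.
Local Open Scope classical_set_scope.
Local Open Scope ring_scope.
Set Implicit Arguments.
Unset Strict Implicit.
Unset Printing Implicit Defensive.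

(** The point is explicit: it lies on the diagonal of the unit square and its
    digits alternate, so the nested squares [Q_0], [Q_1], ... containing it are
    alternately the lower left and the upper right subsquare. Because of the
    alternation the point stays at a distance of at least one eighth of the side
    from the boundary of each [Q_n] ([relpos_mid], [nested_square_far]), even if
    the ratios tend to [1 / 2] and the subsquares nearly touch.

    Let [T_n] be the integral of the kernel over the ring between [Q_n] and
    [Q_(n+1)], and [A_n = 4 ^ n * sigma_n]. If the ratios were constant, the
    reflection in the centre of the square would carry the picture in [Q_n],
    rescaled, to the picture in [Q_(n+1)]; as [1 / z] is odd and homogeneous of
    degree [-1], [A_n * T_n] would change sign with [n]. In general
    [A_n * T_n + A_(n+1) * T_(n+1)] is controlled by a geometrically weighted
    sum of the variations of the following ratios ([ring_pair]), which is
    summable in [n] by bounded variation. Since [A_n * T_n] is bounded and [A_n]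
    increases to infinity, Dirichlet's test shows that the series of the [T_n]
    converges ([cvg_outer]). Replacing squares by discs costs [O(1 / A_n)]
    ([truncated_near_outer]), so the principal value exists.

    For the Lebesgue point, let [z] be at distance at most [r] from the point,
    with [r] comparable to [sigma_n]. The part of the Cauchy integral coming from
    outside [Q_n] differs at [z] and at the point by a bounded multiple of the sum
    of the [1 / A_k], [k < n], with weights [2 ^- (n - k)] ([outer_shift]), and
    this tends to 0. The
    part coming from [Q_n] is bounded by the potential of a mass [4 ^- n]; by
    Tonelli's theorem and the local integrability of [1 / |z|] in the plane
    ([potential_disc]) its average over the disc is [O(4 ^- n / r)], that is
    [O(1 / A_n)].

    Real and imaginary parts are treated together, through the few properties
    of [cauchy_like] kernels. *)

(** * Positions of the intervals of the one-dimensional construction *)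

Section positions.
Context {R : realType}.
Implicit Types (lam : nat -> R) (u w : seq bool) (n m k : nat).

Definition ratios_from lam n : nat -> R := fun k => lam (n + k)%N.

Definition contracting lam := forall n, (1 <= n)%N -> 0 < lam n < 2^-1.

(** The left end of an interval: both coordinates of the corners of the planar
    squares are of this form, so the geometry is done one coordinate at a time.
    As in the planar construction, the head of the word is the last digit. *)
Fixpoint pos lam u : R :=
  if u is b :: u' then
    pos lam u' + b%:R * (sigma lam (size u') - lam (size u) * sigma lam (size u'))
  else 0.

Lemma sigma0 lam : sigma lam 0 = 1.
Proof. by rewrite /sigma big_nil. Qed.

Lemma sigmaS lam n : sigma lam n.+1 = sigma lam n * lam n.+1.
Proof. by rewrite /sigma big_nat_recr. Qed.

Lemma cantor_squareE lam (w : seq (bool * bool)) :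
  cantor_square lam w =
    ((pos lam (map fst w), pos lam (map snd w)), sigma lam (size w)).
Proof.
elim: w => [|v w IH] /=; first by rewrite /sigma big_nil.
rewrite IH /subsquare /= !size_map; congr (_, _).
by rewrite sigmaS mulrC.
Qed.

Lemma sigmaD lam n m :
  sigma lam (n + m) = sigma lam n * sigma (ratios_from lam n) m.
Proof.
elim: m => [|m IH]; first by rewrite addn0 sigma0 mulr1.
by rewrite addnS !sigmaS IH mulrA /ratios_from addnS.
Qed.

Lemma contracting_from lam n : contracting lam -> contracting (ratios_from lam n).
Proof. by move=> h k k1; apply: h; rewrite (leq_trans k1)// leq_addl. Qed.

Lemma sigma_gt0 lam n : contracting lam -> 0 < sigma lam n.
Proof.
move=> h; elim: n => [|n IH]; first by rewrite sigma0.
by rewrite sigmaS mulr_gt0//; case/andP: (h n.+1 isT).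
Qed.

Lemma sigma_le lam n : contracting lam -> sigma lam n <= 2^-1 ^+ n.
Proof.
move=> h; elim: n => [|n IH]; first by rewrite sigma0.
rewrite sigmaS exprSr; case/andP: (h n.+1 isT) => /ltW ? /ltW ?.
by rewrite ler_pM// ltW// sigma_gt0.
Qed.

(** Self-similarity: inside an interval one sees the construction with the
    remaining ratios. *)
Lemma pos_cat lam u w :
  pos lam (u ++ w) =
    pos lam w + sigma lam (size w) * pos (ratios_from lam (size w)) u.
Proof.
elim: u => [|b u IH] /=; first by rewrite mulr0 addr0.
rewrite IH size_cat addnC sigmaD /ratios_from addnS; ring.
Qed.

Lemma pos_bounds lam u :
  contracting lam -> 0 <= pos lam u /\ pos lam u + sigma lam (size u) <= 1.
Proof.
move=> h; elim: u => [|b u [IH1 IH2]] /=; first by rewrite sigma0; lra.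
have s0 := sigma_gt0 (size u) h; rewrite sigmaS.
have /andP[l0 l1] := h (size u).+1 isT.
by case: b; rewrite ?mul1r ?mul0r; split; nra.
Qed.

(** Flipping every digit is the reflection in the middle of the interval. *)
Lemma pos_flip lam u :
  pos lam (map negb u) = 1 - sigma lam (size u) - pos lam u.
Proof.
elim: u => [|b u IH] /=; first by rewrite sigma0; ring.
by rewrite IH sigmaS !size_map; case: b => /=; ring.
Qed.

(** A geometrically weighted sum of the next [m] variations of the ratios. *)
Fixpoint drift lam m n : R :=
  if m is m'.+1 then `|lam n.+1 - lam n.+2| + drift lam m' n.+1 / 2 else 0.

Lemma drift_ge0 lam m n : 0 <= drift lam m n.
Proof. by elim: m n => //= m IH n; rewrite addr_ge0// divr_ge0. Qed.

(** Changing the first ratio moves a point by at most that change, and the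
    motion caused by the later ratios is contracted by a factor at most [1 / 2].
    This is where bounded variation enters: successive generations look alike up
    to an error whose sum over all generations is finite, by [sum_drift]. *)
Lemma pos_drift lam u n : contracting lam ->
  `|pos (ratios_from lam n) u - pos (ratios_from lam n.+1) u|
    <= drift lam (size u) n.
Proof.
move=> h; elim/last_ind: u n => [|u b IH] n /=; first by rewrite subrr normr0.
rewrite size_rcons /= -cats1 !pos_cat /= !sigmaS !sigma0 /=.
rewrite (_ : ratios_from (ratios_from lam n) 1 = ratios_from lam n.+1); last first.
  by apply/funext => k; rewrite /ratios_from; congr lam; lia.
rewrite (_ : ratios_from (ratios_from lam n.+1) 1 = ratios_from lam n.+2); last first.
  by apply/funext => k; rewrite /ratios_from; congr lam; lia.
rewrite /ratios_from !addn1 -/(ratios_from lam n.+1) -/(ratios_from lam n.+2).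
have [p0 p1] := pos_bounds u (contracting_from n.+1 h).
have s0 := sigma_gt0 (size u) (contracting_from n.+1 h).
have := IH n.+1; set p := pos _ u in p0 p1 *; set q := pos _ u => pq.
have /andP[l0 l1] := h n.+1 isT; have /andP[l20 l21] := h n.+2 isT.
set x := lam n.+1 in l0 l1 *; set y := lam n.+2 in l20 l21 *.
rewrite (_ : _ - _ = (x - y) * (p - b%:R) + y * (p - q)); last by ring.
rewrite (le_trans (ler_normD _ _))// !normrM lerD//.
  by rewrite ler_piMr// ler_norml; apply/andP; case: b => /=; split; lra.
by rewrite mulrC ler_pM// gtr0_norm//; lra.
Qed.

Lemma sum_drift lam (D : R) :
  (forall N, \sum_(0 <= n < N) `|lam n.+1 - lam n.+2| <= D) ->
  forall m N, \sum_(0 <= n < N) drift lam m n <= 2 * D.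
Proof.
move=> hD; have D0 : 0 <= D by have := hD 0; rewrite big_nil.
elim=> [|m IH] N /=; first by rewrite big1// mulr_ge0.
rewrite big_split /= -mulr_suml.
have -> : 2 * D = D + (2 * D) / 2 by field.
rewrite lerD// ler_pM2r//; apply: le_trans (IH N.+1).
by rewrite big_nat_recl//= ler_wpDl// drift_ge0.
Qed.

(** Indexes the intervals containing the chosen point; the first digit, stored
    last, is 0. *)
Fixpoint zigzag n : seq bool := if n is n'.+1 then odd n' :: zigzag n' else [::].

Lemma size_zigzag n : size (zigzag n) = n.
Proof. by elim: n => //= n ->. Qed.

Lemma zigzag_point lam : contracting lam ->
  exists t : R, forall n, pos lam (zigzag n) <= t <= pos lam (zigzag n) + sigma lam n.
Proof.
move=> h; pose c n := pos lam (zigzag n).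
have cS n : c n.+1 = c n + (odd n)%:R * (sigma lam n - lam n.+1 * sigma lam n).
  by rewrite /c /= size_zigzag.
have nd : nondecreasing_seq c.
  apply/nondecreasing_seqP => n; rewrite cS; have s0 := sigma_gt0 n h.
  by have /andP[] := h n.+1 isT; case: (odd n); rewrite ?mul1r ?mul0r; nra.
have ni : nonincreasing_seq (fun n => c n + sigma lam n).
  apply/nonincreasing_seqP => n; rewrite cS sigmaS; have s0 := sigma_gt0 n h.
  by have /andP[] := h n.+1 isT; case: (odd n); rewrite ?mul1r ?mul0r; nra.
have ub k n : c k <= c n + sigma lam n.
  have s0 := sigma_gt0 (maxn k n) h.
  apply: le_trans (ni _ _ (leq_maxr k n)).
  apply: (le_trans (nd _ _ (leq_maxl k n))); lra.
exists (sup (range c)) => n; apply/andP; split.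
  apply: ub_le_sup; last by exists n.
  by exists (c 0 + sigma lam 0) => _ [k _ <-].
by apply: ge_sup => [|_ [k _ <-]]; [exists (c 0%N); exists 0%N | exact: ub].
Qed.

End positions.

(** * The point with alternating digits *)

Section zigzag.
Context {R : realType}.
Variables (lam : nat -> R) (t : R).
Hypothesis lamC : contracting lam.
Hypothesis lam4 : forall n, (1 <= n)%N -> 4^-1 <= lam n.
Hypothesis tE : forall n, pos lam (zigzag n) <= t <= pos lam (zigzag n) + sigma lam n.

Definition relpos n : R := (t - pos lam (zigzag n)) / sigma lam n.

Lemma relposE n : t = pos lam (zigzag n) + sigma lam n * relpos n.
Proof. by rewrite /relpos mulrC divfK ?gt_eqF ?sigma_gt0// addrC subrK. Qed.

Lemma relposS n : relpos n = (odd n)%:R * (1 - lam n.+1) + lam n.+1 * relpos n.+1.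
Proof.
have s0 : sigma lam n != 0 by rewrite gt_eqF ?sigma_gt0.
have /andP[l0 _] := @lamC n.+1 isT; have {}l0 : lam n.+1 != 0 by rewrite gt_eqF.
rewrite /relpos /= size_zigzag sigmaS; field; exact/andP.
Qed.

Lemma relpos01 n : 0 <= relpos n <= 1.
Proof.
have s0 := sigma_gt0 n lamC; have /andP[t0 t1] := tE n.
by rewrite /relpos ler_pdivrMr// ler_pdivlMr// mul0r mul1r; apply/andP; split; lra.
Qed.

(** Among two consecutive digits one is 0 and the other 1, which pushes the
    point away from both ends of its interval at every scale. *)
Lemma relpos_mid n : 8^-1 <= relpos n <= 1 - 8^-1.
Proof.
rewrite relposS (relposS n.+1) /=; have /andP[p0 p1] := relpos01 n.+2.
have /andP[l0 l1] := @lamC n.+1 isT; have /andP[k0 k1] := @lamC n.+2 isT.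
have := @lam4 n.+1 isT; have := @lam4 n.+2 isT.
set p := relpos _ in p0 p1 *; set l := lam n.+1 in l0 l1 *; set k := lam n.+2 in k0 k1 *.
move=> k4 l4.
have kp0 : 0 <= k * p by rewrite mulr_ge0// ltW.
have kp1 : k * p <= k by rewrite ler_piMr// ltW.
move: (k * p) kp0 kp1 => w w0 w1.
case: (odd n) => /=; rewrite ?mul1r ?mul0r ?add0r; apply/andP; split; nra.
Qed.

(** Reflecting the alternating word shifts it by one digit: two consecutive
    relative positions would be symmetric about [1 / 2] if the ratios were
    constant. *)
Lemma relpos_drift m n : `|relpos n + relpos n.+1 - 1| <= drift lam m n + 2^-1 ^+ m.
Proof.
elim: m n => [|m IH] n /=.
  have := relpos01 n; have := relpos01 n.+1.
  by rewrite add0r expr0 ler_norml => /andP[? ?] /andP[? ?]; apply/andP; split; lra.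
rewrite (relposS n) {2}(relposS n.+1) /=.
have := IH n.+1; have := relpos01 n.+1.
have /andP[k0 k1] := @lamC n.+2 isT; have /andP[l0 l1] := @lamC n.+1 isT.
set p := relpos n.+1; set q := relpos n.+2; set l := lam n.+1; set k := lam n.+2.
move=> /andP[p0 p1] pq.
rewrite (_ : _ - 1 = (l - k) * (p - (odd n)%:R) + k * (p + q - 1)); last first.
  by case: (odd n) => /=; ring.
rewrite exprS -[leRHS]addrA (le_trans (ler_normD _ _))// !normrM lerD//.
  by rewrite ler_piMr// ler_norml; apply/andP; case: (odd n) => /=; split; lra.
rewrite [_ / 2]mulrC -mulrDr ler_pM// gtr0_norm//; exact: ltW.
Qed.

(** A cell of the [n]-th interval and the reflected cell of the next one lie in
    nearly opposite directions from the point, once each is rescaled. *)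
Lemma relpos_mirror n (u : seq bool) (x y : R) :
  pos lam (u ++ zigzag n) <= x <= pos lam (u ++ zigzag n) + sigma lam (size u + n) ->
  pos lam (map negb u ++ zigzag n.+1) <= y
    <= pos lam (map negb u ++ zigzag n.+1) + sigma lam (size u + n.+1) ->
  `|(t - x) / sigma lam n + (t - y) / sigma lam n.+1|
    <= 2 * drift lam (size u) n + 3 * 2^-1 ^+ size u.
Proof.
rewrite !pos_cat !size_zigzag pos_flip !(addnC (size u)) !sigmaD.
set s := sigma lam n; set s' := sigma lam n.+1.
have s0 : 0 < s := sigma_gt0 n lamC; have s'0 : 0 < s' := sigma_gt0 n.+1 lamC.
rewrite [X in (X - x) / _](relposE n) [X in (X - y) / _](relposE n.+1) -/s -/s'.
have := relpos_drift (size u) n; have := pos_drift u n lamC.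
have := sigma_le (size u) (contracting_from n lamC).
have := sigma_le (size u) (contracting_from n.+1 lamC).
set Z := pos (ratios_from lam n) u; set Z' := pos (ratios_from lam n.+1) u.
set r := sigma (ratios_from lam n) _; set r' := sigma (ratios_from lam n.+1) _.
set c := pos lam (zigzag n); set c' := pos lam (zigzag n.+1).
set e := _ ^+ _; set d := drift _ _ _.
move=> r'e re; rewrite !ler_norml => /andP[z1 z2] /andP[q1 q2] /andP[x1 x2] /andP[y1 y2].
pose X := (x - c) / s; pose Y := (y - c') / s'.
have xE : x = c + s * X by rewrite /X mulrC divfK ?gt_eqF// addrC subrK.
have yE : y = c' + s' * Y by rewrite /Y mulrC divfK ?gt_eqF// addrC subrK.
have X1 : Z <= X by rewrite -(ler_pM2l s0); lra.
have X2 : X <= Z + r by rewrite -(ler_pM2l s0) mulrDr; lra.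
have Y1 : 1 - r' - Z' <= Y by rewrite -(ler_pM2l s'0); lra.
have Y2 : Y <= 1 - Z' by rewrite -(ler_pM2l s'0); lra.
rewrite (_ : (_ - x) / s = relpos n - X); last by rewrite xE; field; rewrite gt_eqF.
rewrite (_ : (_ - y) / s' = relpos n.+1 - Y); last by rewrite yE; field; rewrite gt_eqF.
by apply/andP; split; lra.
Qed.

End zigzag.

(** * Kernels behaving like the Cauchy kernel *)

Section modulus.
Context {R : realType}.
Implicit Types z w : R[i].

Lemma cmod_ge0 z : 0 <= cmod z.
Proof. by case: z => x y; exact: sqrtr_ge0. Qed.

Lemma cmodD z w : cmod (z + w) <= cmod z + cmod w.
Proof. exact: le_normcD. Qed.

Lemma cmodN z : cmod (- z) = cmod z.
Proof. exact: normcN. Qed.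

Lemma cmodB z w : cmod (z - w) = cmod (w - z).
Proof. by rewrite -cmodN opprB. Qed.

Lemma cmodM z w : cmod (z * w) = cmod z * cmod w.
Proof. exact: ComplexField.Normc.normcM. Qed.

Lemma cmodV z : cmod z^-1 = (cmod z)^-1.
Proof. exact: ComplexField.Normc.normcV. Qed.

Lemma cmod_gt0 z : 0 < cmod z -> z != 0.
Proof. by apply: contraTneq => ->; rewrite /cmod ComplexField.Normc.normc0 ltxx. Qed.

Lemma cmod_real (x : R) : cmod x%:C%C = `|x|.
Proof. by rewrite /cmod /= [0 ^+ 2]expr0n /= addr0 sqrtr_sqr. Qed.

Lemma cmod_ge_Re z : `|complex.Re z| <= cmod z.
Proof. by case: z => x y /=; rewrite -sqrtr_sqr ler_sqrt ?lerDl ?addr_ge0 ?sqr_ge0. Qed.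

Lemma cmod_ge_Im z : `|complex.Im z| <= cmod z.
Proof. by case: z => x y /=; rewrite -sqrtr_sqr ler_sqrt ?lerDr ?addr_ge0 ?sqr_ge0. Qed.

Lemma cmod_le z : cmod z <= `|complex.Re z| + `|complex.Im z|.
Proof.
case: z => x y /=; rewrite -(@ler_pXn2r _ 2)// ?nnegrE ?sqrtr_ge0 ?addr_ge0//.
rewrite sqr_sqrtr ?addr_ge0 ?sqr_ge0// sqrrD !real_normK ?num_real//.
by rewrite addrAC lerDl mulrn_wge0// mulr_ge0.
Qed.

End modulus.

(** The properties of [Re (1 / z)] and [Im (1 / z)] on which the argument rests. *)
Record cauchy_like (R : realType) (K : R[i] -> R) : Prop := CauchyLike {
  clN : forall z, K (- z) = - K z;
  clZ : forall (s : R) z, 0 < s -> K (s%:C%C * z) = s^-1 * K z;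
  cl_size : forall z, `|K z| <= (cmod z)^-1;
  cl_lip : forall z w, z != 0 -> w != 0 ->
    `|K z - K w| <= cmod (z - w) / (cmod z * cmod w);
  cl_meas : measurable_fun setT (fun z : plane R => K (toC z)) }.

Section kernels.
Context {R : realType}.

Lemma measurable_inv_sqr_cmod : measurable_fun setT
  (fun z : plane R => ((z.1 : R) ^+ 2 + (z.2 : R) ^+ 2)^-1).
Proof.
(* [0 ^-1 = 0] agrees with the value of [powR] at 0. *)
rewrite (_ : (fun _ => _) =
  (@powR R ^~ (-1)) \o (fun z : plane R => (z.1 : R) ^+ 2 + (z.2 : R) ^+ 2)); last first.
  by apply/funext => z /=; rewrite powR_inv1// addr_ge0// sqr_ge0.
apply: measurableT_comp; first exact: measurable_powR.
by apply: measurable_funD; apply: measurable_funX.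
Qed.

Lemma measurable_disc (z : plane R) (r : R) : measurable (disc z r).
Proof.
have [r0|r0] := leP r 0.
  rewrite (_ : disc z r = set0)//; apply/seteqP; split => w //=; rewrite /disc /=.
  by move=> h; have := le_lt_trans (cmod_ge0 (toC w - toC z)) (lt_le_trans h r0); rewrite ltxx.
pose f (w : plane R) : R := ((w.1 : R) - (z.1 : R)) ^+ 2 + ((w.2 : R) - (z.2 : R)) ^+ 2.
have mf : measurable_fun setT f.
  apply: measurable_funD; apply: measurable_funX; apply: measurable_funB => //.
rewrite (_ : disc z r = setT `&` f @^-1` `]-oo, r ^+ 2[).
  by apply: mf => //; exact: measurable_itv.
rewrite setTI; apply/seteqP; split => w; rewrite /disc /= in_itv /= -/(f w).
  rewrite -[X in _ -> X < _]sqr_sqrtr ?addr_ge0 ?sqr_ge0//.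
  by rewrite ltr_pXn2r ?nnegrE ?sqrtr_ge0// ltW.
rewrite -[X in X < _ -> _]sqr_sqrtr ?addr_ge0 ?sqr_ge0//.
by rewrite ltr_pXn2r ?nnegrE ?sqrtr_ge0// ltW.
Qed.

Let inv_lip (z w : R[i]) : z != 0 -> w != 0 ->
  cmod (z^-1 - w^-1) = cmod (z - w) / (cmod z * cmod w).
Proof.
move=> z0 w0; rewrite -cmodM -cmodV -cmodM -[LHS]cmodN; congr cmod.
by field; rewrite z0 w0.
Qed.

Lemma Re_inv_cauchy_like : cauchy_like (fun z : R[i] => complex.Re z^-1).
Proof.
split=> [z|s z s0|z|z w z0 w0|].
- by rewrite invrN; case: (z^-1).
- rewrite invfM -fmorphV; case: (z^-1) => x y /=; ring.
- by rewrite -cmodV cmod_ge_Re.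
- rewrite -inv_lip// (le_trans _ (cmod_ge_Re _))//.
  by case: (z^-1) => ? ?; case: (w^-1).
- rewrite (_ : (fun _ => _) = (fun z : plane R => (z.1 : R)) \*
    (fun z : plane R => ((z.1 : R) ^+ 2 + (z.2 : R) ^+ 2)^-1)); last by apply/funext => z.
  by apply: measurable_funM; [exact: measurable_fst|exact: measurable_inv_sqr_cmod].
Qed.

Lemma Im_inv_cauchy_like : cauchy_like (fun z : R[i] => complex.Im z^-1).
Proof.
split=> [z|s z s0|z|z w z0 w0|].
- by rewrite invrN; case: (z^-1).
- rewrite invfM -fmorphV; case: (z^-1) => x y /=; ring.
- by rewrite -cmodV cmod_ge_Im.
- rewrite -inv_lip// (le_trans _ (cmod_ge_Im _))//.
  by case: (z^-1) => ? ?; case: (w^-1).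
- rewrite (_ : (fun _ => _) = (fun z : plane R => - (z.2 : R)) \*
    (fun z : plane R => ((z.1 : R) ^+ 2 + (z.2 : R) ^+ 2)^-1)); last first.
    by apply/funext => z /=; rewrite mulNr.
  apply: measurable_funM; last exact: measurable_inv_sqr_cmod.
  by apply: measurableT_comp => //; exact: measurable_snd.
Qed.

End kernels.

(** * Integrals of bounded functions against a probability *)

Section bounded_integrals.
Context {d} {T : measurableType d} {R : realType} (mu : probability T R).
Implicit Types (D E : set T) (f : T -> R).

Lemma bounded_integrable D f (M : R) : measurable D -> measurable_fun setT f ->
  (forall x, D x -> `|f x| <= M) -> mu.-integrable D (EFin \o f).
Proof.
move=> mD mf fM; apply: measurable_bounded_integrable => //.
- by rewrite (le_lt_trans (probability_le1 mu mD))// ltry.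
- exact: measurable_funTS.
- exists M; split; first exact: num_real.
  by move=> x /ltW Mx y /= Dy; rewrite (le_trans (fM _ Dy)).
Qed.

Lemma Rintegral_near_cst D f (k e : R) : measurable D -> measurable_fun setT f ->
  (forall x, D x -> `|f x - k| <= e) ->
  `|\int[mu]_(x in D) f x - k * fine (mu D)| <= e * fine (mu D).
Proof.
move=> mD mf fe; rewrite -!Rintegral_cst// -RintegralB//; last 2 first.
- apply: (@bounded_integrable _ _ (`|k| + e)) => // x Dx.
  by rewrite -[f x](subrK k) addrC (le_trans (ler_normD _ _))// lerD2l fe.
- exact: (@bounded_integrable _ _ `|k|).
have mfk : measurable_fun setT (fun x => f x - k) by exact: measurable_funB.
rewrite (le_trans (le_normr_Rintegral _ _))//; first exact: (@bounded_integrable _ _ e).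
apply: le_Rintegral => //.
- apply: (@bounded_integrable _ _ e) => // [|x Dx]; first exact: measurableT_comp.
  by rewrite normr_id fe.
- exact: (@bounded_integrable _ _ `|e|).
Qed.

Lemma Rintegral_bound D f (e : R) : measurable D -> measurable_fun setT f ->
  (forall x, D x -> `|f x| <= e) ->
  `|\int[mu]_(x in D) f x| <= e * fine (mu D).
Proof.
move=> mD mf fe; rewrite -[X in `|X|]subr0 -(mul0r (fine (mu D))).
by apply: Rintegral_near_cst => // x Dx; rewrite subr0 fe.
Qed.

Lemma Rintegral_full_subset D E f : measurable D -> measurable E -> E `<=` D ->
  mu D = mu E -> measurable_fun setT f -> mu.-integrable D (EFin \o f) ->
  \int[mu]_(x in D) f x = \int[mu]_(x in E) f x.
Proof.
move=> mD mE ED muDE mf intf.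
have mDE : measurable (D `\` E) by exact: measurableD.
have N0 : mu (D `\` E) = 0%E.
  rewrite measureD//; last by rewrite (le_lt_trans (probability_le1 mu mD))// ltry.
  rewrite (setIidr ED); transitivity (mu E - mu E)%E; first by congr (_ - _)%E.
  by rewrite subee// fin_num_measure.
rewrite -[in LHS](setDUK ED) Rintegral_setU//; last 2 first.
- rewrite (setDUK ED); exact: intf.
- by apply/disj_setPS => x [? []].
rewrite [X in _ + X](_ : _ = 0) ?addr0// /Rintegral null_set_integral//.
by apply/measurable_EFinP; exact: measurable_funTS.
Qed.

End bounded_integrals.

(** An integral of a nonnegative function is a supremum over simple functions,
    hence monotone even where the functions are not measurable. *)
Lemma ge0_le_integral_any d (T : measurableType d) (R : realType)
    (mu : {measure set T -> \bar R}) (D : set T) (f g : T -> \bar R) :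
  (forall x, D x -> 0 <= f x)%E -> (forall x, D x -> f x <= g x)%E ->
  (\int[mu]_(x in D) f x <= \int[mu]_(x in D) g x)%E.
Proof.
move=> f0 fg; have g0 x : D x -> (0 <= g x)%E.
  by move=> Dx; exact: le_trans (f0 _ Dx) (fg _ Dx).
rewrite !ge0_integralE//; apply: ereal_sup_le => _ [h hf <-]; exists h => // x.
by apply: (le_trans (hf x)); apply: lee_restrict.
Qed.

(** * Convergence of sequences and series *)

Section sequences_lemmas.
Context {R : realType}.
Implicit Types (A T x e : nat -> R).

(** Twice a partial sum is the partial sum of the sums of consecutive terms, up
    to the two boundary terms. *)
Lemma cvg_series_of_pairs T (D : R) :
  (forall N, \sum_(0 <= n < N) `|T n + T n.+1| <= D) -> T @ \oo --> (0 : R) ->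
  cvgn (series T).
Proof.
move=> hD T0; pose P n := T n + T n.+1.
have cP : cvgn (series P).
  apply: normed_cvg; apply: nondecreasing_is_cvgn.
    by apply/nondecreasing_seqP => n; rewrite /= seriesSr lerDl.
  by exists D => _ [N _ <-]; exact: hD.
have -> : series T = (fun N => 2^-1 * (series P N + T 0%N - T N)).
  apply/funext => N; elim: N => [|N IH].
    by rewrite !seriesEnat /= !big_geq// add0r subrr mulr0.
  by rewrite !seriesSr IH /P; field.
apply: is_cvgM; first exact: is_cvg_cst.
apply: is_cvgB; last by apply/cvg_ex; exists 0.
by apply: is_cvgD => //; exact: is_cvg_cst.
Qed.

(** Bounded terms of nearly alternating sign, divided by weights which increase
    to infinity: Dirichlet's test. *)
Lemma cvg_series_alternating A T (C D : R) :
  (forall n, 1 <= A n) -> nondecreasing_seq A -> A n @[n --> \oo] --> +oo ->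
  (forall n, `|T n| <= C / A n) ->
  (forall N, \sum_(0 <= n < N) `|A n * T n + A n.+1 * T n.+1| <= D) ->
  cvgn (series T).
Proof.
move=> A1 ndA Aoo TC hD.
have A0 n : 0 < A n by rewrite (lt_le_trans _ (A1 n)).
have C0 : 0 <= C by have := le_trans (normr_ge0 _) (TC 0%N); rewrite pmulr_lge0 ?invr_gt0.
have iA : (fun n => (A n)^-1) @ \oo --> (0 : R).
  by apply/gtr0_cvgV0 => //; exact: nearW.
apply: (@cvg_series_of_pairs _ (D + C)) => [N|]; last first.
  apply/cvgr0Pnorm_le => eps eps0.
  have : (fun n => C * (A n)^-1) @ \oo --> (C * 0 : R) by exact: cvgMl_tmp.
  rewrite mulr0 => /cvgr0Pnorm_le /(_ eps eps0); apply: filterS => n.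
  by apply: le_trans; rewrite (le_trans (TC n))// ler_norm.
have step n : `|T n + T n.+1| <= `|A n * T n + A n.+1 * T n.+1|
    + (C / A n - C / A n.+1).
  rewrite (_ : T n + T n.+1 = (A n * T n + A n.+1 * T n.+1) / A n
     + T n.+1 * ((A n - A n.+1) / A n)); last by field; rewrite gt_eqF.
  rewrite (le_trans (ler_normD _ _))// lerD//.
    rewrite normrM ler_piMr// gtr0_norm ?invr_gt0//.
    by rewrite invf_le1.
  have AA := ndA _ _ (leqnSn n).
  rewrite (_ : C / A n - C / A n.+1 = C / A n.+1 * ((A n.+1 - A n) / A n)); last first.
    by field; rewrite !gt_eqF.
  have q0 : 0 <= (A n.+1 - A n) / A n by rewrite divr_ge0 ?subr_ge0//; exact/ltW.
  rewrite normrM (_ : `|(A n - A n.+1) / A n| = (A n.+1 - A n) / A n).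
    by rewrite ler_wpM2r.
  by rewrite -[RHS]ger0_norm// -normrN -mulNr opprB.
apply: (le_trans (ler_sum_nat _)) => [n _|]; first exact: step.
rewrite big_split/= lerD//; under eq_bigr do rewrite -opprB.
rewrite sumrN telescope_sumr// opprB lerBlDr.
have : C / A 0%N <= C by rewrite ler_piMr// invf_le1.
move/le_trans; apply; rewrite lerDl divr_ge0//; exact/ltW.
Qed.

Definition halving_mean e n := \sum_(0 <= k < n) 2^-1 ^+ (n - k) * e k.

Lemma halving_meanS e n : halving_mean e n.+1 = 2^-1 * (halving_mean e n + e n).
Proof.
rewrite /halving_mean big_nat_recr//= subSnn expr1 mulrDr mulr_sumr; congr (_ + _).
rewrite !big_nat; apply: eq_bigr => k /andP[_ kn].
by rewrite subSn 1?ltnW// exprS mulrA.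
Qed.

Lemma halving_mean_cvg0 e : (forall n, 0 <= e n) -> e @ \oo --> (0 : R) ->
  halving_mean e @ \oo --> (0 : R).
Proof.
move=> e_ge0 e0.
have x_ge0 n : 0 <= halving_mean e n.
  by apply: sumr_ge0 => k _; rewrite mulr_ge0// exprn_ge0.
apply/cvgr0Pnorm_le => eps eps0.
have eps2 : 0 < eps / 2 by rewrite divr_gt0.
move/cvgr0Pnorm_le/(_ _ eps2) : e0 => [N _ hN].
have geo j : halving_mean e (N + j) <= eps / 2 + halving_mean e N * 2^-1 ^+ j.
  elim: j => [|j IH]; first by rewrite addn0 expr0 mulr1 lerDr ltW.
  rewrite addnS halving_meanS exprS.
  have := hN (N + j)%N (leq_addr _ _); rewrite /= ger0_norm//.
  by move: IH; set y := _ ^+ j; lra.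
have : (fun j => halving_mean e N * 2^-1 ^+ j) @ \oo --> (halving_mean e N * 0 : R).
  by apply: cvgMl_tmp; apply: cvg_expr; rewrite ger0_norm// invf_lt1// ltr1n.
rewrite mulr0 => /cvgr0Pnorm_le/(_ _ eps2)[M _ hM].
exists (N + M)%N => // n /= /subnKC <-; rewrite -addnA ger0_norm//.
apply: (le_trans (geo _)); rewrite [leRHS](splitr eps) lerD2l.
by apply: le_trans (ler_norm _) _; apply: hM; exact: leq_addr.
Qed.

End sequences_lemmas.

(** * The potential of a measure in the plane *)

Section riesz_potential.
Context {R : realType}.
Implicit Types (z w : plane R).
Local Notation L := (lebesgue_plane R).

(** Balls of the maximum norm, whose area needs no polar coordinates. *)
Definition box w (h : R) : set (plane R) :=
  [set z | `|(z.1 : R) - (w.1 : R)| <= h /\ `|(z.2 : R) - (w.2 : R)| <= h].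

Lemma boxE w h : box w h =
  `[(w.1 : R) - h, (w.1 : R) + h] `*` `[(w.2 : R) - h, (w.2 : R) + h].
Proof.
by apply/seteqP; split => z; rewrite /box /= !in_itv /= !ler_distl.
Qed.

Lemma measurable_box w h : measurable (box w h).
Proof. by rewrite boxE; apply: measurableX; exact: measurable_itv. Qed.

Lemma lebesgue_box w h : 0 <= h -> L (box w h) = ((2 * h) ^+ 2)%:E.
Proof.
move=> h0; rewrite boxE; set I := `[_, _]%classic; set J := `[_, _]%classic.
transitivity (@lebesgue_measure R I * @lebesgue_measure R J)%E.
  by apply: product_measure1E; exact: measurable_itv.
rewrite !lebesgue_measure_itv /= !lte_fin.
have aux (x : R) : (if x - h < x + h then ((x + h)%:E - (x - h)%:E)%E else 0%E) = (2 * h)%:E.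
  case: ltP => hh; first by rewrite -EFinB; congr EFin; ring.
  by congr EFin; lra.
by rewrite !aux -EFinM expr2.
Qed.

Lemma lebesgue_plane_sigma_finite : sigma_finite setT L.
Proof.
exists (fun n => box (0, 0) n%:R); last first.
  move=> n; split; first exact: measurable_box.
  by rewrite lebesgue_box// ltry.
apply/esym/seteqP; split => // z _.
exists (Num.bound (`|(z.1 : R)| + `|(z.2 : R)|)) => //.
have := archi_boundP (addr_ge0 (normr_ge0 (z.1 : R)) (normr_ge0 (z.2 : R))).
set b := _%:R; rewrite /box /= !subr0 => /ltW zb.
by split; apply: le_trans zb; rewrite ?lerDl ?lerDr.
Qed.

Lemma disc_sub_box w (r : R) : disc w r `<=` box w r.
Proof.
move=> z wz; have := cmod_ge_Re (toC z - toC w); have := cmod_ge_Im (toC z - toC w).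
by move=> h1 h2; split; [apply: (le_trans h2)|apply: (le_trans h1)]; exact: ltW.
Qed.

Lemma box_sub_disc w (r : R) : 0 < r -> box w (r / 4) `<=` disc w r.
Proof.
move=> r0 z [h1 h2]; rewrite /disc /=.
apply: (le_lt_trans (cmod_le (toC z - toC w))); rewrite /= in h1 h2 *; lra.
Qed.

Lemma lebesgue_disc w (r : R) : 0 < r ->
  exists2 m : R, r ^+ 2 / 4 <= m <= 4 * r ^+ 2 & L (disc w r) = m%:E.
Proof.
move=> r0; have mD := measurable_disc w r; have r4 : 0 <= r / 4 by lra.
have ub : (L (disc w r) <= (4 * r ^+ 2)%:E)%E.
  rewrite (_ : 4 * r ^+ 2 = (2 * r) ^+ 2); last by ring.
  rewrite -(lebesgue_box w (ltW r0)) le_measure ?inE//; first exact: measurable_box.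
  exact: disc_sub_box.
have lb : ((r ^+ 2 / 4)%:E <= L (disc w r))%E.
  rewrite (_ : r ^+ 2 / 4 = (2 * (r / 4)) ^+ 2); last by field.
  rewrite -(lebesgue_box w r4) le_measure ?inE//; first exact: measurable_box.
  exact: box_sub_disc.
have fin : L (disc w r) \is a fin_num.
  by rewrite ge0_fin_numE// (le_lt_trans ub)// ltry.
exists (fine (L (disc w r))); last by rewrite fineK.
by rewrite -!lee_fin fineK// lb ub.
Qed.

(** The Riesz kernel of order 1, with the value 0 on the diagonal. *)
Definition riesz z w : \bar R := ((cmod (toC z - toC w))^-1)%:E.

Lemma riesz_ge0 z w : (0 <= riesz z w)%E.
Proof. by rewrite lee_fin invr_ge0 cmod_ge0. Qed.

Lemma measurable_riesz :
  measurable_fun setT (fun zw : plane R * plane R => riesz zw.1 zw.2).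
Proof.
apply/measurable_EFinP.
pose f (zw : plane R * plane R) : R :=
  ((zw.1.1 : R) - (zw.2.1 : R)) ^+ 2 + ((zw.1.2 : R) - (zw.2.2 : R)) ^+ 2.
rewrite (_ : (fun _ => _) = (@powR R ^~ (- 2^-1)) \o f); last first.
  apply/funext => zw; rewrite /= powRN powR12_sqrt//.
  by rewrite addr_ge0// sqr_ge0.
apply: measurableT_comp; first exact: measurable_powR.
by apply: measurable_funD; apply: measurable_funX; apply: measurable_funB;
  do 2 apply: measurableT_comp => //.
Qed.

Let shell w (r : R) j z : \bar R := ((2 ^+ j.+1 / r) * \1_(box w (r / 2 ^+ j)) z)%:E.

Let shell_ge0 w (r : R) j z : 0 < r -> (0 <= shell w r j z)%E.
Proof.
by move=> r0; rewrite lee_fin mulr_ge0// divr_ge0 ?exprn_ge0// ltW.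
Qed.

(* The least [j] with [r / 2 ^+ j] at most the distance gives the shell that
   dominates the kernel; beyond distance [r] the constant [r^-1] does. *)
Let riesz_le_shells w (r : R) z : 0 < r ->
  (riesz z w <= (r^-1)%:E + \sum_(j <oo) shell w r j z)%E.
Proof.
move=> r0; rewrite /riesz; set d := cmod _.
have S0 : (0 <= \sum_(j <oo) shell w r j z)%E.
  by apply: nneseries_ge0 => j _ _; exact: shell_ge0.
have d0 : 0 <= d := cmod_ge0 _.
have [rd|dr] := leP r d.
  rewrite -[leLHS]adde0 leeD// lee_fin lef_pV2 ?posrE//; exact: lt_le_trans rd.
move: d0; rewrite le_eqVlt => /predU1P[<-|d0].
  by rewrite invr0 adde_ge0// lee_fin invr_ge0 ltW.
have ex : exists j, r / 2 ^+ j <= d.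
  have : (fun m => r * 2^-1 ^+ m) @ \oo --> (r * 0 : R).
    by apply: cvgMl_tmp; apply: cvg_expr; rewrite ger0_norm// invf_lt1// ltr1n.
  rewrite mulr0 => /cvgr0Pnorm_le/(_ _ d0)[m _ hm].
  exists m; have := hm m (leqnn m); rewrite /= exprVn; apply: le_trans.
  exact: ler_norm.
case: (ex_minnP ex) => -[|j] hj jmin.
  by move: hj dr; rewrite expr0 divr1 => /le_lt_trans/[apply]; rewrite ltxx.
have dj : d <= r / 2 ^+ j.
  by rewrite leNgt; apply/negP => /ltW/jmin; rewrite ltnn.
have zb : box w (r / 2 ^+ j) z.
  split; apply: le_trans dj; [exact: (cmod_ge_Re (toC z - toC w))|].
  exact: (cmod_ge_Im (toC z - toC w)).
rewrite -[leLHS]add0e leeD// ?lee_fin ?invr_ge0 ?(ltW r0)//.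
apply: (@le_trans _ _ (shell w r j z)).
  rewrite /shell lee_fin indicE mem_set// mulr1.
  rewrite -[leRHS]invrK lef_pV2 ?posrE ?invr_gt0 ?divr_gt0 ?exprn_gt0//.
  by rewrite invf_div.
apply: (le_trans _ (nneseries_lim_ge j.+1 _)) => [|? _ _]; last exact: shell_ge0.
rewrite big_nat_recr//= leeDr// sume_ge0// => ? _; exact: shell_ge0.
Qed.

(** [1 / |z|] is locally integrable in the plane, with the bound dictated by
    homogeneity: the shell at distance [r / 2 ^+ j] contributes at most
    [8 * r / 2 ^+ j]. *)
Lemma riesz_disc a w (r : R) : 0 < r ->
  (\int[L]_(z in disc a r) riesz z w <= (20 * r)%:E)%E.
Proof.
move=> r0; have mD := measurable_disc a r.
have mshell j : measurable_fun (disc a r) (shell w r j).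
  apply/measurable_EFinP; apply: measurable_funM => //.
  by apply: measurable_indic; exact: measurable_box.
have mnew : measurable_fun (disc a r) (fun z => riesz z w).
  apply: measurable_funTS.
  exact: (measurableT_comp measurable_riesz (pair2_measurable w)).
have [m /andP[m1 m2] mE] := lebesgue_disc a r0.
have mS : measurable_fun (disc a r) (fun z => \sum_(j <oo) shell w r j z)%E.
  by apply: ge0_emeasurable_sum => // j z _ _; exact: shell_ge0.
apply: (@le_trans _ _ (\int[L]_(z in disc a r)
    ((r^-1)%:E + \sum_(j <oo) shell w r j z)))%E.
  apply: ge0_le_integral => //; first by move=> z _; exact: riesz_ge0.
    by apply: emeasurable_funD.
  by move=> z _; exact: riesz_le_shells.
rewrite ge0_integralD//; last 2 first.
- by move=> z _; rewrite lee_fin invr_ge0 ltW.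
- by move=> z _; apply: nneseries_ge0 => j _ _; exact: shell_ge0.
rewrite (_ : 20 * r = 4 * r + 16 * r); last by ring.
rewrite EFinD leeD//.
  rewrite integral_cst// mE -EFinM lee_fin mulrC ler_pdivrMr// -mulrA -expr2; lra.
rewrite integral_nneseries//; last by move=> j z _; exact: shell_ge0.
have shell_int j : (\int[L]_(z in disc a r) shell w r j z <= (8 * r / 2 ^+ j)%:E)%E.
  have p0 : 0 < 2 ^+ j :> R by rewrite exprn_gt0.
  rewrite /shell; under eq_integral do rewrite EFinM.
  rewrite ge0_integralZl_EFin//; last 2 first.
  - by apply/measurable_EFinP; apply: measurable_indic; exact: measurable_box.
  - by rewrite divr_ge0 ?exprn_ge0// ltW.
  rewrite integral_indic//; last exact: measurable_box.
  have -> : 8 * r / 2 ^+ j = 2 ^+ j.+1 / r * (2 * (r / 2 ^+ j)) ^+ 2.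
    by rewrite exprS; field; rewrite !gt_eqF.
  rewrite [leRHS]EFinM lee_wpmul2l//; first by rewrite lee_fin divr_ge0 ?exprn_ge0// ltW.
  rewrite -(@lebesgue_box w); last by rewrite divr_ge0// ltW.
  by rewrite le_measure ?inE//; [apply: measurableI => //|]; exact: measurable_box.
apply: lime_le.
  by apply: is_cvg_nneseries => j _ _; apply: integral_ge0 => z _; exact: shell_ge0.
apply: nearW => N; apply: (@le_trans _ _ (\sum_(0 <= j < N) (8 * r / 2 ^+ j)%:E)%E).
  by apply: lee_sum => j _; exact: shell_int.
rewrite sumEFin lee_fin.
have -> : \sum_(0 <= j < N) 8 * r / 2 ^+ j = 16 * r - 16 * r / 2 ^+ N.
  elim: N => [|N IH]; first by rewrite big_geq// expr0 divr1 subrr.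
  by rewrite big_nat_recr//= IH exprS; field; rewrite gt_eqF// exprn_gt0.
by rewrite gerBl divr_ge0 ?exprn_ge0// mulr_ge0// ltW.
Qed.

(** By Tonelli, the potential of a measure has small averages wherever the
    measure of the charged set is small compared with the radius. *)
Lemma potential_disc (mu : probability (plane R) R) (E : set (plane R)) a (r : R) :
  measurable E -> 0 < r ->
  (\int[L]_(z in disc a r) \int[mu]_(w in E) riesz z w <= (20 * r)%:E * mu E)%E.
Proof.
move=> mE r0; have mD := measurable_disc a r.
pose f (zw : plane R * plane R) : \bar R :=
  ((\1_(disc a r) zw.1)%:E * (\1_E zw.2)%:E * riesz zw.1 zw.2)%E.
have f0 zw : (0 <= f zw)%E.
  by apply: mule_ge0; [rewrite -EFinM lee_fin mulr_ge0|exact: riesz_ge0].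
have mf : measurable_fun setT f.
  apply: emeasurable_funM; last exact: measurable_riesz.
  apply: emeasurable_funM; apply/measurable_EFinP.
  - by apply: measurableT_comp => //; exact: measurable_indic.
  - by apply: measurableT_comp => //; exact: measurable_indic.
have e1 : (\int[L]_(z in disc a r) \int[mu]_(w in E) riesz z w =
           \int[L]_z \int[mu]_w f (z, w))%E.
  rewrite [LHS]integral_mkcond; apply: eq_integral => z _; rewrite /patch.
  case: ifPn => zD; last first.
    rewrite integral0_eq// => w _; rewrite /f /= indicE (negbTE zD).
    by rewrite mul0e mul0e.
  rewrite [LHS]integral_mkcond; apply: eq_integral => w _; rewrite /patch /f /=.
  by rewrite !indicE zD mul1e; case: ifPn => _; rewrite ?mul1e ?mul0e.
have e2 : (\int[mu]_w \int[L]_z f (z, w) =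
    \int[mu]_(w in E) \int[L]_(z in disc a r) riesz z w)%E.
  rewrite [RHS]integral_mkcond; apply: eq_integral => w _; rewrite /patch.
  case: ifPn => wE; last first.
    rewrite integral0_eq// => z _; rewrite /f /= (indicE _ E) (negbTE wE).
    by rewrite mule0 mul0e.
  rewrite [RHS]integral_mkcond; apply: eq_integral => z _; rewrite /patch /f /=.
  by rewrite !indicE wE mule1; case: ifPn => _; rewrite ?mul1e ?mul0e.
have e3 : (\int[L]_z \int[mu]_w f (z, w) = \int[mu]_w \int[L]_z f (z, w))%E.
  (* Tonelli's theorem requires the planar measure as a sigma-finite one. *)
  pose sfL := Measure_isSigmaFinite.Build _ _ _ L lebesgue_plane_sigma_finite.
  pose L' : {sigma_finite_measure set (plane R) -> \bar R} := HB.pack (Measure.sort L) L sfL.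
  exact: (@fubini_tonelli _ _ (plane R) (plane R) R L' mu f mf f0).
rewrite e1 e3 e2.
apply: (@le_trans _ _ (\int[mu]_(w in E) (20 * r)%:E)%E); last by rewrite integral_cst.
apply: ge0_le_integral_any => w _; last exact: riesz_disc.
by apply: integral_ge0 => z _; exact: riesz_ge0.
Qed.

End riesz_potential.

(** * The squares of the planar construction *)

Section cells.
Context {R : realType} (lam : nat -> R) (mu : probability (plane R) R).
Hypothesis lamC : contracting lam.
Hypothesis muE : forall w : seq (bool * bool),
    mu (square (cantor_square lam w)) = ((4 ^+ size w)^-1)%:E.
Implicit Types (u w : seq (bool * bool)).

Definition cell w : set (plane R) := square (cantor_square lam w).

Definition in_side (v : seq bool) (x : R) :=
  pos lam v <= x <= pos lam v + sigma lam (size v).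

Lemma cellP w (z : plane R) :
  cell w z <-> in_side (map fst w) z.1 /\ in_side (map snd w) z.2.
Proof. by rewrite /cell /square /in_side cantor_squareE /= !size_map. Qed.

Lemma measurable_cell w : measurable (cell w).
Proof.
rewrite (_ : cell w =
  `[(cantor_square lam w).1.1, (cantor_square lam w).1.1 + (cantor_square lam w).2]
  `*` `[(cantor_square lam w).1.2, (cantor_square lam w).1.2 + (cantor_square lam w).2]).
  by apply: measurableX; exact: measurable_itv.
by apply/seteqP; split => z /=; rewrite !in_itv.
Qed.

Lemma mu_cell w : fine (mu (cell w)) = (4 ^+ size w)^-1.
Proof. by rewrite muE. Qed.

Lemma in_side_cat (u v : seq bool) x : in_side (u ++ v) x -> in_side v x.
Proof.
rewrite /in_side pos_cat size_cat addnC sigmaD.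
have [p0 p1] := pos_bounds u (contracting_from (size v) lamC).
by have := sigma_gt0 (size v) lamC => s0 /andP[x0 x1]; apply/andP; split; nra.
Qed.

Lemma cell_cat u w : cell (u ++ w) `<=` cell w.
Proof.
by move=> z /cellP; rewrite !map_cat => -[/in_side_cat ? /in_side_cat ?]; apply/cellP.
Qed.

Lemma in_side_digit (b b' : bool) (v : seq bool) x :
  in_side (b :: v) x -> in_side (b' :: v) x -> b = b'.
Proof.
rewrite /in_side /= sigmaS; have := sigma_gt0 (size v) lamC.
have /andP[] := lamC (isT : (1 <= (size v).+1)%N).
by case: b b' => -[] //=; nra.
Qed.

(** Ratios below [1 / 2] keep the four subsquares disjoint. *)
Lemma cell_digit v v' w z : cell (v :: w) z -> cell (v' :: w) z -> v = v'.
Proof.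
case: v v' => [a b] [a' b'] /cellP[/= h1 h2] /cellP[/= k1 k2].
by rewrite (in_side_digit h1 k1) (in_side_digit h2 k2).
Qed.

(** The four subsquares carry the whole mass of their square: what lies between
    them is negligible. *)
Lemma cell_children w (f : plane R -> R) (M : R) : measurable_fun setT f ->
  (forall x, `|f x| <= M) ->
  \int[mu]_(x in cell w) f x =
    \int[mu]_(x in cell ((false, false) :: w)) f x +
    \int[mu]_(x in cell ((false, true) :: w)) f x +
    \int[mu]_(x in cell ((true, false) :: w)) f x +
    \int[mu]_(x in cell ((true, true) :: w)) f x.
Proof.
move=> mf fM; have If D : measurable D -> mu.-integrable D (EFin \o f).
  by move=> mD; exact: (@bounded_integrable _ _ _ _ _ _ M).
pose C v := cell (v :: w); have mC v : measurable (C v) by exact: measurable_cell.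
have dis v v' : v != v' -> C v `&` C v' = set0.
  by move=> vv'; apply/seteqP; split => z // -[h /(cell_digit h)/eqP]; rewrite (negbTE vv').
pose E3 := C (false, false) `|` C (false, true) `|` C (true, false).
have mE2 : measurable (C (false, false) `|` C (false, true)) by exact: measurableU.
have mE3 : measurable E3 by exact: measurableU.
have d2 : C (false, false) `&` C (false, true) = set0 by exact: dis.
have d3 : (C (false, false) `|` C (false, true)) `&` C (true, false) = set0.
  by rewrite setIUl !dis// setU0.
have d4 : E3 `&` C (true, true) = set0 by rewrite /E3 !setIUl !dis// !setU0.
have mE : measurable (E3 `|` C (true, true)) by exact: measurableU.
rewrite (@Rintegral_full_subset _ _ _ mu _ (E3 `|` C (true, true)))//.
- rewrite Rintegral_setU//; [|exact: If|exact/disj_set2P].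
  rewrite Rintegral_setU//; [|exact: If|exact/disj_set2P].
  by rewrite Rintegral_setU//; [exact: If|exact/disj_set2P].
- exact: measurable_cell.
- by move=> z [[[|]|]|] => h; exact: (@cell_cat [:: _]) h.
- have muC v : mu (C v) = ((4 ^+ (size w).+1)^-1)%:E := muE (v :: w).
  rewrite !measureU//; pose c := ((4 ^+ (size w).+1)^-1)%:E : \bar R.
  transitivity (c + c + c + c)%E; last by congr (_ + _ + _ + _)%E; exact/esym/muC.
  rewrite /cell muE -!EFinD; congr EFin.
  by rewrite exprS; field; rewrite expf_neq0// pnatr_eq0.
- by apply: If; exact: measurable_cell.
Qed.

End cells.

(** * Near antisymmetry of consecutive rings *)

Section rings.
Context {R : realType} (lam : nat -> R) (t : R) (mu : probability (plane R) R).
Hypothesis lamC : contracting lam.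
Hypothesis lam4 : forall n, (1 <= n)%N -> 4^-1 <= lam n.
Hypothesis tE : forall n, pos lam (zigzag n) <= t <= pos lam (zigzag n) + sigma lam n.
Hypothesis muE : forall w : seq (bool * bool),
    mu (square (cantor_square lam w)) = ((4 ^+ size w)^-1)%:E.
Implicit Types (u w : seq (bool * bool)) (z : plane R).

Definition zigzag2 n : seq (bool * bool) := map (fun b => (b, b)) (zigzag n).

Definition nested_square n : set (plane R) := cell lam (zigzag2 n).

Local Notation Q := nested_square.

Let a : plane R := (t, t).

Let s n : R := sigma lam n.

Let s0 n : 0 < s n. Proof. exact: sigma_gt0. Qed.

Let s_ge0 n : 0 <= s n. Proof. exact/ltW/s0. Qed.

Lemma size_zigzag2 n : size (zigzag2 n) = n.
Proof. by rewrite size_map size_zigzag. Qed.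

Lemma zigzag2_coord n : (map fst (zigzag2 n) = zigzag n) * (map snd (zigzag2 n) = zigzag n).
Proof. by split; rewrite /zigzag2 -map_comp -[RHS]map_id; apply: eq_map. Qed.

Lemma measurable_nested_square n : measurable (Q n).
Proof. exact: measurable_cell. Qed.

Lemma mu_nested_square n : fine (mu (Q n)) = (4 ^+ n)^-1.
Proof. by rewrite mu_cell// size_zigzag2. Qed.

Lemma nested_square_center n : Q n a.
Proof. by apply/cellP; rewrite !zigzag2_coord /in_side size_zigzag /=; split; exact: tE. Qed.

Lemma nested_square_sub n : Q n.+1 `<=` Q n.
Proof. exact: (@cell_cat _ _ lamC [:: (odd n, odd n)]). Qed.

Lemma sigma_antitone n m : (n <= m)%N -> s m <= s n.
Proof.
move=> nm; rewrite -(subnKC nm) /s sigmaD ler_piMr ?s_ge0//.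
rewrite (le_trans (sigma_le _ (contracting_from n lamC)))//.
by apply: exprn_ile1; lra.
Qed.

Lemma sigma_quarter n : s n <= 4 * s n.+1.
Proof.
rewrite /s sigmaS mulrCA ler_peMr ?s_ge0//.
by have := @lam4 n.+1 isT; lra.
Qed.

(** The point is well inside each of its squares, hence far from everything
    outside, however close to [1 / 2] the ratios are. *)
Lemma nested_square_far n z : ~ Q n z -> s n / 8 <= cmod (toC a - toC z).
Proof.
move=> nQ; have /andP[r0 r1] := relpos_mid lamC lam4 tE n.
have tr := relposE t lamC n; have sn := s0 n.
have aux (x : R) : ~ in_side lam (zigzag n) x -> s n / 8 <= `|t - x|.
  move=> nx; rewrite leNgt; apply/negP; rewrite ltr_norml => /andP[h1 h2].
  by apply: nx; rewrite /in_side size_zigzag -/(s n) in tr sn *; apply/andP; split; nra.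
have [h1|/aux h1] := pselect (in_side lam (zigzag n) z.1); last first.
  by rewrite (le_trans h1)// (cmod_ge_Re (toC a - toC z)).
have [h2|/aux h2] := pselect (in_side lam (zigzag n) z.2); last first.
  by rewrite (le_trans h2)// (cmod_ge_Im (toC a - toC z)).
by exfalso; apply: nQ; apply/cellP; rewrite !zigzag2_coord.
Qed.

Lemma disc_sub_nested_square n r : r <= s n / 8 -> disc a r `<=` Q n.
Proof.
move=> rs z az; apply: contrapT => /nested_square_far; apply/negP; rewrite -ltNge cmodB.
exact: lt_le_trans rs.
Qed.

(** The reflection of the unit square in its centre, acting on words. *)
Definition flip u := map (fun v => (~~ v.1, ~~ v.2)) u.

Definition rescaled_dir n z : R[i] := ((s n)^-1)%:C%C * (toC a - toC z).

Lemma rescaled_dir_mirror n u z z' :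
  cell lam (u ++ zigzag2 n) z -> cell lam (flip u ++ zigzag2 n.+1) z' ->
  cmod (rescaled_dir n z + rescaled_dir n.+1 z') <=
    4 * drift lam (size u) n + 6 * 2^-1 ^+ size u.
Proof.
move=> /cellP[]; rewrite !map_cat !zigzag2_coord => zx zy.
have f1 : map fst (flip u) = map negb (map fst u) by rewrite /flip -!map_comp.
have f2 : map snd (flip u) = map negb (map snd u) by rewrite /flip -!map_comp.
move=> /cellP[]; rewrite !map_cat !zigzag2_coord f1 f2 => zx' zy'.
rewrite /in_side !size_cat !size_map !size_zigzag in zx zy zx' zy'.
have := @relpos_mirror _ _ _ lamC tE n (map fst u) z.1 z'.1.
have := @relpos_mirror _ _ _ lamC tE n (map snd u) z.2 z'.2.
rewrite !size_map => /(_ zy zy') h2 /(_ zx zx') h1.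
apply: (le_trans (cmod_le _)).
rewrite (_ : complex.Re _ = (t - z.1) / s n + (t - z'.1) / s n.+1); last first.
  by rewrite /rescaled_dir /=; ring.
rewrite (_ : complex.Im _ = (t - z.2) / s n + (t - z'.2) / s n.+1); last first.
  by rewrite /rescaled_dir /=; ring.
rewrite -/(s n) -/(s n.+1) in h1 h2; lra.
Qed.

Lemma rescaled_dir_far n z : ~ Q n.+1 z -> 32^-1 <= cmod (rescaled_dir n z).
Proof.
move=> /nested_square_far h; rewrite /rescaled_dir cmodM cmod_real gtr0_norm ?invr_gt0//.
rewrite mulrC ler_pdivlMr//; have := sigma_quarter n; lra.
Qed.

Section kernel.
Variable K : R[i] -> R.
Hypothesis KC : cauchy_like K.

Lemma measurable_kernel_at z : measurable_fun setT (fun w : plane R => K (toC z - toC w)).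
Proof.
rewrite (_ : (fun _ => _) = (fun z : plane R => K (toC z)) \o
  (fun w : plane R => ((z.1 : R) - (w.1 : R), (z.2 : R) - (w.2 : R)) : plane R)); last first.
  by apply/funext.
apply: measurableT_comp; first exact: cl_meas KC.
apply: measurable_fun_pair; exact: measurable_funB.
Qed.

Lemma kernel_rescaled_dir n z : s n * K (toC a - toC z) = K (rescaled_dir n z).
Proof. by rewrite /rescaled_dir (clZ KC) ?invr_gt0// invrK. Qed.

Lemma kernel_far n z : ~ Q n z -> `|K (toC a - toC z)| <= 8 / s n.
Proof.
move=> /nested_square_far h; rewrite (le_trans (cl_size KC _))//.
rewrite -[leRHS]invrK lef_pV2 ?posrE ?invr_gt0 ?divr_gt0//.
  by rewrite invf_div.
by rewrite (lt_le_trans _ h)// divr_gt0.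
Qed.

(** Vanishing on the next square makes it bounded, so that its integrals may be
    subdivided into cells without singling out the cells inside that square. *)
Definition cutoff n : plane R -> R := (fun z => K (toC a - toC z)) \_ (~` Q n.+1).

Lemma measurable_cutoff n : measurable_fun setT (cutoff n).
Proof.
have mQ : measurable (~` Q n.+1) by apply: measurableC; exact: measurable_nested_square.
have [+ _] := measurable_restrictT (fun z => K (toC a - toC z)) mQ; apply.
exact: (measurable_funTS (measurable_kernel_at a)).
Qed.

Lemma cutoff_in n z : Q n.+1 z -> cutoff n z = 0.
Proof. by move=> h; rewrite /cutoff /patch ifF//; apply/memNset; apply. Qed.

Lemma cutoff_out n z : ~ Q n.+1 z -> cutoff n z = K (toC a - toC z).
Proof. by move=> h; rewrite /cutoff /patch mem_set. Qed.

Lemma cutoff_le n z : `|cutoff n z| <= 8 / s n.+1.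
Proof.
have [h|h] := pselect (Q n.+1 z); first by rewrite cutoff_in// normr0 divr_ge0.
by rewrite cutoff_out// kernel_far.
Qed.

(** Oddness of the kernel makes nearly opposite directions cancel; [32 * 32]
    bounds the Lipschitz constant of the kernel at distance [32^-1] from 0. *)
Lemma kernel_mirror n (e : R) z z' : ~ Q n.+1 z -> ~ Q n.+2 z' ->
  cmod (rescaled_dir n z + rescaled_dir n.+1 z') <= e ->
  `|s n * K (toC a - toC z) + s n.+1 * K (toC a - toC z')| <= 32 * 32 * e.
Proof.
move=> /rescaled_dir_far h /rescaled_dir_far h' he; rewrite !kernel_rescaled_dir.
rewrite -[K (rescaled_dir n.+1 z')]opprK -(clN KC).
have h0 : 0 < cmod (rescaled_dir n z) by rewrite (lt_le_trans _ h).
have h'0 : 0 < cmod (rescaled_dir n.+1 z') by rewrite (lt_le_trans _ h').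
apply: (le_trans (cl_lip KC _ _)); rewrite ?oppr_eq0 ?cmod_gt0// opprK cmodN.
rewrite ler_pdivrMr ?mulr_gt0//.
have h1 : 1 <= (32 * cmod (rescaled_dir n z)) * (32 * cmod (rescaled_dir n.+1 z')).
  by apply: mulr_ege1; rewrite mulrC -ler_pdivrMr// mul1r.
have e0 : 0 <= e := le_trans (cmod_ge0 _) he.
rewrite (le_trans he)// (_ : _ * e * _ =
  e * ((32 * cmod (rescaled_dir n z)) * (32 * cmod (rescaled_dir n.+1 z')))); last by ring.
by rewrite ler_peMr.
Qed.

End kernel.

End rings.

Section ring_integrals.
Context {R : realType} (lam : nat -> R) (t : R) (mu : probability (plane R) R).
Hypothesis lamC : contracting lam.
Hypothesis lam4 : forall n, (1 <= n)%N -> 4^-1 <= lam n.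
Hypothesis tE : forall n, pos lam (zigzag n) <= t <= pos lam (zigzag n) + sigma lam n.
Hypothesis muE : forall w : seq (bool * bool),
    mu (square (cantor_square lam w)) = ((4 ^+ size w)^-1)%:E.
Variable K : R[i] -> R.
Hypothesis KC : cauchy_like K.
Implicit Types (u w : seq (bool * bool)) (z : plane R).

Let s n : R := sigma lam n.
Let s0 n : 0 < s n. Proof. exact: sigma_gt0. Qed.
Let s_ge0 n : 0 <= s n. Proof. exact/ltW/s0. Qed.

Local Notation a := ((t, t) : plane R).
Local Notation Q := (nested_square lam).
Local Notation cutoff := (cutoff lam t K).

Let cellint n u := \int[mu]_(z in cell lam (u ++ zigzag2 n)) cutoff n z.

Let cellint_near n u (c e : R) :
  (forall z, cell lam (u ++ zigzag2 n) z -> `|s n * cutoff n z - c| <= e) ->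
  `|4 ^+ n * (s n * cellint n u) - (4 ^+ size u)^-1 * c| <= (4 ^+ size u)^-1 * e.
Proof.
move=> h; have mC := measurable_cell lam (u ++ zigzag2 n).
have mcut := measurable_cutoff lam t KC n.
have := @Rintegral_near_cst _ _ _ mu _ (fun z => s n * cutoff n z) c e mC _ h.
rewrite RintegralZl//; last first.
  by apply: (@bounded_integrable _ _ _ _ _ _ (8 / s n.+1)) => // z _; exact: cutoff_le.
rewrite (mu_cell muE) size_cat size_zigzag2 exprD invfM -/(cellint n u) => /(_ _)h'.
have {}h' := h' (measurable_funM (measurable_cst _) mcut).
have p4 : 0 < 4 ^+ n :> R by rewrite exprn_gt0.
rewrite -(ler_pM2l p4) -{1}(gtr0_norm p4) -normrM in h'.
move: h'; rewrite (_ : 4 ^+ n * (e * _) = (4 ^+ size u)^-1 * e); last first.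
  by field; rewrite !expf_neq0// pnatr_eq0.
apply: le_trans; rewrite le_eqVlt; apply/orP; left; apply/eqP; congr `|_|.
by field; rewrite !expf_neq0// pnatr_eq0.
Qed.

Lemma cell_inhabited w : exists z : plane R, cell lam w z.
Proof.
exists (pos lam (map fst w), pos lam (map snd w)); apply/cellP => /=.
by rewrite /in_side !lexx !size_map !lerDl -/(s _) s_ge0.
Qed.

Lemma flip_rcons u v : flip (rcons u v) = rcons (flip u) (~~ v.1, ~~ v.2).
Proof. by rewrite /flip map_rcons. Qed.

Lemma cell_rcons_out n u v z : v != (odd n, odd n) ->
  cell lam (rcons u v ++ zigzag2 n) z -> ~ Q n.+1 z.
Proof.
move=> vn; rewrite cat_rcons => /(cell_cat lamC) h h'.
by move/eqP: vn; apply; exact: (cell_digit lamC h h').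
Qed.

Lemma cell_rcons_in n u z :
  cell lam (rcons u (odd n, odd n) ++ zigzag2 n) z -> Q n.+1 z.
Proof. by rewrite cat_rcons => /(cell_cat lamC). Qed.

Let err m n : R := 3 * (32 * 32 * (4 * drift lam m n + 6 * 2^-1 ^+ m)).

(* The cells indexed by [u] and by its reflection are compared through the value
   at one point of the first: the kernel on the second is within one error of
   its opposite, and on the first within two, whence the factor 3. *)
Let pair_leaf n u : (0 < size u)%N ->
  `|4 ^+ n * (s n * cellint n u) + 4 ^+ n.+1 * (s n.+1 * cellint n.+1 (flip u))|
    <= (4 ^+ size u)^-1 * err (size u) n.
Proof.
have szf w : size (flip w) = size w by rewrite size_map.
case/lastP: u => // u v _; set m := size _.
set e := 32 * 32 * (4 * drift lam m n + 6 * 2^-1 ^+ m).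
have e0 : 0 <= e.
  by rewrite !mulr_ge0// addr_ge0// mulr_ge0// ?drift_ge0// exprn_ge0.
have [vn|vn] := eqVneq v (odd n, odd n).
  have i1 : `|4 ^+ n * (s n * cellint n (rcons u v)) - (4 ^+ m)^-1 * 0| <= (4 ^+ m)^-1 * 0.
    apply: cellint_near => z; rewrite vn => /cell_rcons_in h.
    by rewrite cutoff_in// mulr0 subrr normr0.
  have i2 : `|4 ^+ n.+1 * (s n.+1 * cellint n.+1 (flip (rcons u v)))
       - (4 ^+ size (flip (rcons u v)))^-1 * 0| <= (4 ^+ size (flip (rcons u v)))^-1 * 0.
    apply: cellint_near => z; rewrite vn flip_rcons => /(@cell_rcons_in n.+1) h.
    by rewrite cutoff_in// mulr0 subrr normr0.
  move: i1 i2; rewrite !mulr0 !subr0 !normr_le0 => /eqP-> /eqP->.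
  by rewrite addr0 normr0 mulr_ge0// ?invr_ge0 ?exprn_ge0// mulr_ge0.
have out z : cell lam (rcons u v ++ zigzag2 n) z -> ~ Q n.+1 z by exact: cell_rcons_out.
have out' z : cell lam (flip (rcons u v) ++ zigzag2 n.+1) z -> ~ Q n.+2 z.
  rewrite flip_rcons; apply: cell_rcons_out; apply: contra vn.
  by rewrite (surjective_pairing v) /= !xpair_eqE !(inj_eq negb_inj).
have near z z' : cell lam (rcons u v ++ zigzag2 n) z ->
    cell lam (flip (rcons u v) ++ zigzag2 n.+1) z' ->
    `|s n * K (toC a - toC z) + s n.+1 * K (toC a - toC z')| <= e.
  move=> hz hz'; apply: (kernel_mirror lamC lam4 tE KC (out _ hz) (out' _ hz')).
  exact: (rescaled_dir_mirror lamC tE hz hz').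
have [z0 hz0] := cell_inhabited (rcons u v ++ zigzag2 n).
have [z1 hz1] := cell_inhabited (flip (rcons u v) ++ zigzag2 n.+1).
pose c := s n * K (toC a - toC z0).
have i1 : `|4 ^+ n * (s n * cellint n (rcons u v)) - (4 ^+ m)^-1 * c| <= (4 ^+ m)^-1 * (2 * e).
  apply: cellint_near => z hz; rewrite (cutoff_out _ _ (out _ hz)).
  have := near _ _ hz hz1; have := near _ _ hz0 hz1; rewrite -/c.
  by rewrite !ler_norml => /andP[? ?] /andP[? ?]; apply/andP; split; lra.
have i2 : `|4 ^+ n.+1 * (s n.+1 * cellint n.+1 (flip (rcons u v)))
     - (4 ^+ size (flip (rcons u v)))^-1 * (- c)| <= (4 ^+ size (flip (rcons u v)))^-1 * e.
  apply: cellint_near => z hz; rewrite (cutoff_out _ _ (out' _ hz)) opprK addrC.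
  exact: near.
rewrite szf -/m mulrN opprK in i2.
rewrite (_ : err m n = 2 * e + e); last by rewrite /err -/e; ring.
rewrite [leRHS]mulrDr; apply: le_trans (lerD i1 i2).
apply: le_trans (ler_normD _ _); rewrite le_eqVlt; apply/orP; left; apply/eqP.
by congr `|_|; ring.
Qed.

Let cellint_children n u : cellint n u =
  cellint n ((false, false) :: u) + cellint n ((false, true) :: u) +
  cellint n ((true, false) :: u) + cellint n ((true, true) :: u).
Proof.
apply: (cell_children lamC muE) (measurable_cutoff lam t KC n) _ => z.
exact: (cutoff_le lamC lam4 tE KC).
Qed.

(* Subdividing down to depth [m], where the kernel is almost constant on each
   cell, and adding up. *)
Let pair_cell m n k u : (0 < m)%N -> (size u + k = m)%N ->
  `|4 ^+ n * (s n * cellint n u) + 4 ^+ n.+1 * (s n.+1 * cellint n.+1 (flip u))|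
    <= (4 ^+ size u)^-1 * err m n.
Proof.
move=> m0; elim: k u => [|k IH] u.
  by rewrite addn0 => um; rewrite -um in m0 *; exact: pair_leaf.
move=> um; pose X v := 4 ^+ n * (s n * cellint n (v :: u)) +
  4 ^+ n.+1 * (s n.+1 * cellint n.+1 ((~~ v.1, ~~ v.2) :: flip u)).
pose e := (4 ^+ (size u).+1)^-1 * err m n.
have h v : `|X v| <= e by apply: (IH (v :: u)); rewrite /= -um addSnnS.
have tri (x y bx by_ : R) : `|x| <= bx -> `|y| <= by_ -> `|x + y| <= bx + by_.
  by move=> hx hy; rewrite (le_trans (ler_normD _ _))// lerD.
rewrite (_ : _ + _ = X (false, false) + X (false, true) + X (true, false) + X (true, true)).
  rewrite (_ : _ * err m n = e + e + e + e);
    first exact: (tri _ _ _ _ (tri _ _ _ _ (tri _ _ _ _ (h _) (h _)) (h _)) (h _)).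
  by rewrite /e exprS; field; rewrite expf_neq0// pnatr_eq0.
rewrite (cellint_children n u) (cellint_children n.+1 (flip u)) /X /=.
move: (cellint _ _) (cellint _ _) (cellint _ _) (cellint _ _) => x1 x2 x3 x4.
move: (cellint _ _) (cellint _ _) (cellint _ _) (cellint _ _) => y1 y2 y3 y4.
ring.
Qed.

Let T n : R := \int[mu]_(z in Q n) cutoff n z.

(** The normalised integrals over consecutive rings nearly cancel: the reflection
    in the centre carries one ring to the next up to [drift], and the kernel is
    odd and homogeneous. The depth [m] of the subdivision is arbitrary. *)
Lemma ring_pair m n : (0 < m)%N ->
  `|4 ^+ n * (s n * T n) + 4 ^+ n.+1 * (s n.+1 * T n.+1)|
    <= 3 * (32 * 32 * (4 * drift lam m n + 6 * 2^-1 ^+ m)).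
Proof.
move=> m0; have := @pair_cell m n m [::] m0 erefl.
by rewrite expr0 invr1 mul1r.
Qed.

Lemma ring_le n : `|T n| <= 32 / (4 ^+ n * s n).
Proof.
have := @Rintegral_bound _ _ _ mu (Q n) _ (8 / s n.+1) (measurable_nested_square lam n)
  (measurable_cutoff lam t KC n) (fun z _ => cutoff_le lamC lam4 tE KC n z).
rewrite (mu_nested_square muE); move/le_trans; apply.
rewrite (_ : 32 / (4 ^+ n * s n) = 32 / s n / 4 ^+ n); last by rewrite invfM mulrA mulrAC.
rewrite ler_pM2r ?invr_gt0 ?exprn_gt0//.
rewrite ler_pdivrMr// mulrAC ler_pdivlMr//.
by have := sigma_quarter lamC lam4 n; rewrite -/(s n) -/(s n.+1); lra.
Qed.

End ring_integrals.

(** * Convergence of the truncated integrals *)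

Section principal_value.
Context {R : realType} (lam : nat -> R) (t : R) (mu : probability (plane R) R).
Hypothesis lamC : contracting lam.
Hypothesis lam4 : forall n, (1 <= n)%N -> 4^-1 <= lam n.
Hypothesis tE : forall n, pos lam (zigzag n) <= t <= pos lam (zigzag n) + sigma lam n.
Hypothesis muE : forall w : seq (bool * bool),
    mu (square (cantor_square lam w)) = ((4 ^+ size w)^-1)%:E.
Hypothesis nd : nondecreasing_seq (fun n : nat => 4 ^+ n * sigma lam n).
Hypothesis lim_oo : 4 ^+ n * sigma lam n @[n --> \oo] --> +oo.
Variable D : R.
Hypothesis lam_bv : forall N, \sum_(0 <= n < N) `|lam n.+1 - lam n.+2| <= D.
Implicit Types (z : plane R).

Let s n : R := sigma lam n.
Let s0 n : 0 < s n. Proof. exact: sigma_gt0. Qed.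
Let s_ge0 n : 0 <= s n. Proof. exact/ltW/s0. Qed.

Local Notation a := ((t, t) : plane R).
Local Notation Q := (nested_square lam).
Let A n : R := 4 ^+ n * s n.

Let A1 n : 1 <= A n.
Proof. by have := nd (leq0n n); rewrite expr0 mul1r sigma0. Qed.

Let A0 n : 0 < A n. Proof. by rewrite (lt_le_trans _ (A1 n)). Qed.

Lemma density_cvg0 : (fun n => (A n)^-1) @ \oo --> (0 : R).
Proof. by apply/gtr0_cvgV0 => //; exact: nearW. Qed.

(** The factor 16 keeps a disc of such a radius about the point, and the points
    of that disc, away from the complement of the [n]-th square. *)
Lemma scale_of_radius (N : nat) (r : R) : 0 < r < s N / 16 ->
  exists n, (N <= n)%N /\ s n.+1 / 16 <= r < s n / 16.
Proof.
move=> /andP[r0 rN].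
have ex : exists m, s m / 16 <= r.
  have : (fun m => 1 * 2^-1 ^+ m) @ \oo --> (1 * 0 : R).
    by apply: cvgMl_tmp; apply: cvg_expr; rewrite ger0_norm// invf_lt1// ltr1n.
  rewrite mulr0 => /cvgr0Pnorm_le/(_ _ r0)[m _ hm].
  exists m; have := hm m (leqnn m); rewrite /= mul1r ger0_norm ?exprn_ge0//.
  by have := sigma_le m lamC; have := s_ge0 m; rewrite -/(s m); lra.
case: (ex_minnP ex) => m hm mmin.
have Nm : (N < m)%N.
  rewrite ltnNge; apply/negP => mN; have := sigma_antitone lamC mN.
  by rewrite -/(s N) -/(s m); lra.
case: m hm mmin Nm => // m hm mmin Nm; exists m; split => //.
by rewrite hm ltNge; apply/negP => /mmin; rewrite ltnn.
Qed.

(** The rings fill the first square up to the [n]-th one, and what lies outside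
    the first square is null. *)
Lemma outer_sum (g : plane R -> R) (n : nat) (M : R) : measurable_fun setT g ->
  (forall z, ~ Q n z -> `|g z| <= M) ->
  \int[mu]_(z in ~` Q n) g z =
    \sum_(0 <= k < n) \int[mu]_(z in Q k `\` Q k.+1) g z.
Proof.
move=> mg; have mQ k : measurable (Q k) by exact: measurable_nested_square.
have mQC k : measurable (~` Q k) by exact: measurableC.
elim: n => [|n IH] gM.
  rewrite big_geq// (@Rintegral_full_subset _ _ _ mu _ set0)//.
  - by rewrite Rintegral_set0.
  - rewrite measure0 probability_setC// (_ : mu (Q 0) = 1%E) ?subee//.
    by rewrite /nested_square/= /cell muE expr0 invr1.
  - by apply: (@bounded_integrable _ _ _ mu _ _ M).
have sub z : ~ Q n z -> ~ Q n.+1 z by move=> h /(nested_square_sub lamC).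
have E : ~` Q n.+1 = ~` Q n `|` (Q n `\` Q n.+1).
  apply/seteqP; split => z /=; last by case=> [/sub|[]].
  by move=> h; have [] := pselect (Q n z); [right|left].
have mD : measurable (Q n `\` Q n.+1) by exact: measurableD.
rewrite E Rintegral_setU//; last 2 first.
- by rewrite -E; exact: (@bounded_integrable _ _ _ mu _ _ M).
- by apply/disj_setPS => z [h [/h]].
by rewrite big_nat_recr//= IH// => z /sub/gM.
Qed.

Section kernel.
Variable K : R[i] -> R.
Hypothesis KC : cauchy_like K.

(** Truncation by the squares around the point rather than by discs. *)
Definition outer n : R := \int[mu]_(z in ~` Q n) K (toC a - toC z).

Lemma outer_series : outer = series (fun n => \int[mu]_(z in Q n) cutoff lam t K n z).
Proof.
apply/funext => n; rewrite seriesEnat /outer (@outer_sum _ n (8 / s n)).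
- by apply: eq_bigr => k _; rewrite setDE Rintegral_mkcondr.
- exact: (measurable_kernel_at KC a).
- by move=> z; exact: kernel_far.
Qed.

(** The rings around the point contribute the terms of a nearly alternating
    series divided by the weights [A n], which increase to infinity. *)
Lemma cvg_outer : cvgn outer.
Proof.
rewrite outer_series.
apply: (@cvg_series_alternating _ A _ 32 (3 * (32 * 32 * (4 * (2 * D) + 6)))) => //.
- by move=> n; exact: ring_le.
move=> N; pose T n := \int[mu]_(z in Q n) cutoff lam t K n z.
have bd m : (0 < m)%N -> \sum_(0 <= n < N) `|A n * T n + A n.+1 * T n.+1| <=
    3 * (32 * 32 * (4 * (2 * D) + 6 * (N%:R * 2^-1 ^+ m))).
  move=> m0; apply: (@le_trans _ _ (\sum_(0 <= n < N)
      3 * (32 * 32 * (4 * drift lam m n + 6 * 2^-1 ^+ m)))).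
    apply: ler_sum_nat => n _; have := ring_pair lamC lam4 tE muE KC n m0.
    by rewrite (mulrA (4 ^+ n)) (mulrA (4 ^+ n.+1)).
  rewrite -!mulr_sumr big_split/= -!mulr_sumr !ler_pM2l//.
  rewrite lerD ?ler_pM2l//; first exact: sum_drift.
  by rewrite big_const_nat subn0 iter_addr_0 mulr_natl.
(* The depth is free, so the error [N * 2 ^- m] can be made at most 1. *)
apply: (le_trans (bd N.+1 isT)).
have : N%:R * 2^-1 ^+ N.+1 <= 1 :> R; last by lra.
rewrite exprVn ler_pdivrMr ?exprn_gt0// mul1r -natrX ler_nat.
by rewrite (leq_trans (ltnW (ltn_expl N (isT : (1 < 2)%N))))// leq_exp2l.
Qed.

(** Square and disc truncations at comparable scales differ by the integral over
    a set of mass at most [4 ^- n] where the kernel is at most about [1 / s n]. *)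
Lemma truncated_near_outer n (e : R) : s n.+1 / 16 <= e < s n / 16 ->
  `|\int[mu]_(z in ~` disc a e) K (toC a - toC z) - outer n| <= 64 / A n.
Proof.
move=> /andP[e1 e2]; have e0 : 0 < e.
  by rewrite (lt_le_trans _ e1)// divr_gt0.
have sub : disc a e `<=` Q n.
  by apply: (disc_sub_nested_square lamC lam4 tE); have := s0 n; rewrite -/(s n); lra.
have mQ k : measurable (Q k) by exact: measurable_nested_square.
have mD := measurable_disc a e.
have mQD : measurable (Q n `\` disc a e) by exact: measurableD.
have off z : ~ disc a e z -> `|K (toC a - toC z)| <= e^-1.
  move=> dz; have {dz}h : e <= cmod (toC a - toC z).
    by rewrite cmodB leNgt; exact/negP.
  by rewrite (le_trans (cl_size KC _))// lef_pV2 ?posrE// (lt_le_trans e0).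
have E : ~` disc a e = ~` Q n `|` (Q n `\` disc a e).
  apply/seteqP; split => z /=; last by case=> [h /sub|[]].
  by move=> h; have [] := pselect (Q n z); [right|left].
have mK := measurable_kernel_at KC a.
rewrite E Rintegral_setU//; last 3 first.
- exact: measurableC.
- rewrite -E; apply: (@bounded_integrable _ _ _ mu _ _ e^-1) => //.
  exact: measurableC.
- by apply/disj_setPS => z [h [/h]].
rewrite [X in X - _]addrC /outer addrK.
have h := @Rintegral_bound _ _ _ mu _ _ e^-1 mQD mK (fun z zD => off z zD.2).
apply: (le_trans h).
have mule : fine (mu (Q n `\` disc a e)) <= (4 ^+ n)^-1.
  rewrite -(mu_nested_square muE) fine_le ?fin_num_measure// le_measure ?inE//.
have ie : e^-1 <= 64 / s n.
  rewrite ler_pdivlMr// mulrC ler_pdivrMr//; have := sigma_quarter lamC lam4 n.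
  by rewrite -/(s n) -/(s n.+1); lra.
rewrite (_ : 64 / A n = 64 / s n * (4 ^+ n)^-1); last by rewrite invfM mulrA mulrAC.
by rewrite ler_pM// ?fine_ge0 ?invr_ge0//; exact: ltW.
Qed.

Lemma cvg_truncated :
  \int[mu]_(z in ~` disc a e) K (toC a - toC z) @[e --> (0 : R)^'+] --> limn outer.
Proof.
apply/cvgrPdist_le => eps eps0; have eps2 : 0 < eps / 2 by rewrite divr_gt0.
have /cvgrPdist_le/(_ _ eps2)[N1 _ h1] := cvg_outer.
have : (fun n => 64 * (A n)^-1) @ \oo --> (64 * 0 : R).
  by apply: cvgMl_tmp; exact: density_cvg0.
rewrite mulr0 => /cvgr0Pnorm_le/(_ _ eps2)[N2 _ h2].
pose N := maxn N1 N2.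
have sN : 0 < s N / 16 by rewrite divr_gt0.
near=> e.
have [] := @scale_of_radius N e; first by apply/andP; split; near: e;
  [exact: nbhs_right_gt|exact: nbhs_right_lt].
move=> n [Nn se]; have := truncated_near_outer se.
have := h1 n (leq_trans (leq_maxl _ _) Nn).
have := h2 n (leq_trans (leq_maxr _ _) Nn).
rewrite /= ger0_norm ?mulr_ge0// ?invr_ge0 ?(ltW (A0 n))//.
rewrite !ler_norml => k1 /andP[? ?] /andP[? ?]; apply/andP; split; lra.
Unshelve. all: by end_near. Qed.

End kernel.

End principal_value.

(** * The Cauchy integral near the point *)

Section lebesgue_point.
Context {R : realType} (lam : nat -> R) (t : R) (mu : probability (plane R) R).
Hypothesis lamC : contracting lam.
Hypothesis lam4 : forall n, (1 <= n)%N -> 4^-1 <= lam n.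
Hypothesis tE : forall n, pos lam (zigzag n) <= t <= pos lam (zigzag n) + sigma lam n.
Hypothesis muE : forall w : seq (bool * bool),
    mu (square (cantor_square lam w)) = ((4 ^+ size w)^-1)%:E.
Implicit Types (z w : plane R).

Let s n : R := sigma lam n.
Let s0 n : 0 < s n. Proof. exact: sigma_gt0. Qed.
Let s_ge0 n : 0 <= s n. Proof. exact/ltW/s0. Qed.

Local Notation a := ((t, t) : plane R).
Local Notation Q := (nested_square lam).
Local Notation L := (lebesgue_plane R).
Let A n : R := 4 ^+ n * s n.
Let A0 n : 0 < A n. Proof. by rewrite mulr_gt0// exprn_gt0. Qed.

Let mQ n : measurable (Q n). Proof. exact: measurable_nested_square. Qed.

Definition potential n z : \bar R := \int[mu]_(w in Q n) riesz z w.

Lemma potential_ge0 n z : (0 <= potential n z)%E.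
Proof. by apply: integral_ge0 => w _; exact: riesz_ge0. Qed.

Lemma measurable_potential n : measurable_fun setT (potential n).
Proof.
pose f (zw : plane R * plane R) : \bar R := ((\1_(Q n) zw.2)%:E * riesz zw.1 zw.2)%E.
have -> : potential n = (fun z => \int[mu]_w f (z, w))%E.
  apply/funext => z; rewrite /potential integral_mkcond; apply: eq_integral => w _.
  by rewrite /patch /f /= indicE; case: ifPn => _; rewrite ?mul1e ?mul0e.
apply: (@measurable_fun_fubini_tonelli_F _ _ (plane R) (plane R) R mu f).
  apply: emeasurable_funM; last exact: measurable_riesz.
  by apply/measurable_EFinP; apply: measurableT_comp => //; exact: measurable_indic.
by move=> zw; apply: mule_ge0; [rewrite lee_fin|exact: riesz_ge0].
Qed.

Lemma nested_square_far_disc n z w : disc a (s n / 16) z -> ~ Q n w ->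
  s n / 16 <= cmod (toC z - toC w).
Proof.
move=> az /(nested_square_far lamC lam4 tE) aw.
have tri : cmod (toC a - toC w) <= cmod (toC z - toC a) + cmod (toC z - toC w).
  rewrite [X in _ <= X + _]cmodB; apply: le_trans (cmodD _ _).
  by rewrite (_ : _ + _ = toC a - toC w)//; ring.
have az' : cmod (toC z - toC a) < s n / 16 by [].
rewrite -/(s n) in aw; lra.
Qed.

Section kernel.
Variable K : R[i] -> R.
Hypothesis KC : cauchy_like K.

Let mK z : measurable_fun setT (fun w : plane R => K (toC z - toC w)).
Proof. exact: (measurable_kernel_at KC). Qed.

Let diff z w : R := K (toC z - toC w) - K (toC a - toC w).

Let diff_le n k z w : (k < n)%N -> disc a (s n / 16) z -> ~ Q k.+1 w ->
  `|diff z w| <= 128 * 2^-1 ^+ (n - k) / s k.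
Proof.
move=> kn az nQ; have sk : s n <= s k.+1 by exact: sigma_antitone.
have az' : disc a (s k.+1 / 16) z.
  by apply: (lt_le_trans az); rewrite ler_pM2r.
have h1 := nested_square_far_disc az' nQ.
have h2 := nested_square_far lamC lam4 tE nQ; rewrite -/(s k.+1) in h2.
have s4 := sigma_quarter lamC lam4 k; rewrite -/(s k) -/(s k.+1) in s4.
have sk0 := s0 k; have sk10 := s0 k.+1.
have p1 : 0 < cmod (toC z - toC w) by rewrite (lt_le_trans _ h1)// divr_gt0.
have p2 : 0 < cmod (toC a - toC w) by rewrite (lt_le_trans _ h2)// divr_gt0.
apply: (le_trans (cl_lip KC _ _)); rewrite ?cmod_gt0//.
rewrite (_ : _ - _ = toC z - toC a); last by ring.
have snk : s n <= s k * 2^-1 ^+ (n - k).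
  rewrite -{1}(subnKC (ltnW kn)) /s sigmaD ler_pM2l ?sigma_gt0//.
  exact: (sigma_le _ (contracting_from k lamC)).
have d1 : cmod (toC z - toC a) <= s k * 2^-1 ^+ (n - k) / 16.
  by apply: (le_trans (ltW az)); rewrite ler_pM2r.
have d2 : (s k / 64) * (s k / 32) <= cmod (toC z - toC w) * cmod (toC a - toC w).
  by apply: ler_pM; rewrite ?divr_ge0 ?s_ge0//; lra.
rewrite ler_pdivrMr ?mulr_gt0// (le_trans d1)//.
set e := 2^-1 ^+ _ in d1 *; have e0 : 0 <= e by rewrite exprn_ge0.
apply: le_trans (ler_wpM2l _ d2); last by rewrite divr_ge0// mulr_ge0.
rewrite le_eqVlt; apply/orP; left; apply/eqP; field; exact: lt0r_neq0.
Qed.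

Let measurable_diff z : measurable_fun setT (diff z).
Proof. by apply: measurable_funB; exact: mK. Qed.

(** Moving the point inside a small disc changes the contribution of the far
    rings little: the ring [k] is at distance about [s k] and the displacement
    is at most [s k * 2 ^- (n - k)]. *)
Lemma outer_shift n z : disc a (s n / 16) z ->
  `|\int[mu]_(w in ~` Q n) diff z w| <= 128 * halving_mean (fun k => (A k)^-1) n.
Proof.
move=> az; rewrite (@outer_sum _ _ mu lamC muE (diff z) n (16 / s n + 8 / s n)) => [||w nQ].
- apply: (le_trans (ler_norm_sum _ _ _)).
  rewrite /halving_mean mulr_sumr; apply: ler_sum_nat => k /andP[_ kn].
  have mD : measurable (Q k `\` Q k.+1) by exact: measurableD.
  apply: (le_trans (Rintegral_bound mu mD (measurable_diff z) _)).
    by move=> w [_ nQ]; exact: (diff_le kn az nQ).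
  have mule : fine (mu (Q k `\` Q k.+1)) <= (4 ^+ k)^-1.
    by rewrite -(mu_nested_square muE) fine_le ?fin_num_measure// le_measure ?inE.
  apply: le_trans (ler_wpM2l _ mule) _.
    by rewrite divr_ge0 ?s_ge0// mulr_ge0// exprn_ge0.
  by rewrite /A invfM !mulrA mulrAC.
- exact: measurable_diff.
- rewrite (le_trans (ler_normB _ _))// lerD//; last exact: (kernel_far lamC lam4 tE KC nQ).
  have h := nested_square_far_disc az nQ; have p : 0 < s n / 16 by rewrite divr_gt0.
  rewrite (le_trans (cl_size KC _))// -[leRHS]invrK lef_pV2 ?posrE ?invr_gt0 ?divr_gt0//.
    by rewrite invf_div.
  exact: lt_le_trans h.
Qed.

(** The contribution of the complement of the [n]-th square is almost what it is
    at the point, and the kernel on that square is dominated by the Riesz kernel.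
    Where the potential is infinite the bound is void, so the integral need only
    be meaningful where the potential is finite. *)
Lemma cauchy_near_outer n z (l : R) : disc a (s n / 16) z ->
  (`|\int[mu]_(w in setT) K (toC z - toC w) - l|%:E <=
   (128 * halving_mean (fun k => (A k)^-1) n + `|outer lam t mu K n - l|)%:E
     + potential n z)%E.
Proof.
move=> az.
have [->|/eqP Uoo] := eqVneq (potential n z) +oo%E; first by rewrite addey// leey.
have Ufin : (potential n z < +oo)%E by rewrite ltey; exact/eqP.
have mQC : measurable (~` Q n) by exact: measurableC.
have mE z' : measurable_fun setT (EFin \o (fun w => K (toC z' - toC w))).
  by apply/measurable_EFinP; exact: mK.
have IQ : mu.-integrable (Q n) (EFin \o (fun w => K (toC z - toC w))).
  apply/integrableP; split; first exact: (measurable_funTS (mE z)).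
  apply: le_lt_trans Ufin; apply: ge0_le_integral_any => w _; first exact: abse_ge0.
  by rewrite lee_fin (cl_size KC).
have off w : ~ Q n w -> `|K (toC z - toC w)| <= (s n / 16)^-1.
  move=> nQ; have h := nested_square_far_disc az nQ; have p : 0 < s n / 16 by rewrite divr_gt0.
  by rewrite (le_trans (cl_size KC _))// lef_pV2 ?posrE//; exact: lt_le_trans h.
have IC : mu.-integrable (~` Q n) (EFin \o (fun w => K (toC z - toC w))).
  exact: (bounded_integrable mu mQC (mK z) off).
have ICa : mu.-integrable (~` Q n) (EFin \o (fun w => K (toC a - toC w))).
  exact: (bounded_integrable mu mQC (mK a) (fun w => kernel_far lamC lam4 tE KC (z := w))).
have IT : mu.-integrable (Q n `|` ~` Q n) (EFin \o (fun w => K (toC z - toC w))).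
  apply/integrableP; split; first exact: (measurable_funTS (mE z)).
  rewrite ge0_integral_setU//.
  - by apply: lte_add_pinfty; [case/integrableP : IQ|case/integrableP : IC].
  - by apply: measurable_funTS; apply: measurableT_comp (mE z).
  - by apply/disj_setPS => w [].
rewrite -(setUv (Q n)) Rintegral_setU//; last by apply/disj_setPS => w [].
have sp : \int[mu]_(w in ~` Q n) diff z w =
    \int[mu]_(w in ~` Q n) K (toC z - toC w) - outer lam t mu K n by exact: RintegralB.
have := outer_shift az; rewrite sp.
set y := \int[mu]_(w in ~` Q n) K (toC z - toC w).
set x := \int[mu]_(w in Q n) K (toC z - toC w) => h1.
have h2 : (`|x|%:E <= potential n z)%E.
  rewrite /x EFin_normr_Rintegral//.
  apply: (le_trans (le_abse_integral mu (mQ n) (measurable_funTS (mE z)))).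
  apply: ge0_le_integral_any => w _; first exact: abse_ge0.
  by rewrite lee_fin (cl_size KC).
apply: (@le_trans _ _ ((128 * halving_mean (fun k => (A k)^-1) n +
    `|outer lam t mu K n - l|)%:E + `|x|%:E)%E); last by rewrite leeD2l.
rewrite -EFinD lee_fin.
have := ler_normD x (y - l).
have := ler_normD (y - outer lam t mu K n) (outer lam t mu K n - l).
by rewrite addrA addrNK addrA; lra.
Qed.

End kernel.

End lebesgue_point.

(** * Principal value and Lebesgue point *)

Section conclusion.
Context {R : realType} (lam : nat -> R) (t : R) (mu : probability (plane R) R).
Hypothesis lamC : contracting lam.
Hypothesis lam4 : forall n, (1 <= n)%N -> 4^-1 <= lam n.
Hypothesis tE : forall n, pos lam (zigzag n) <= t <= pos lam (zigzag n) + sigma lam n.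
Hypothesis muE : forall w : seq (bool * bool),
    mu (square (cantor_square lam w)) = ((4 ^+ size w)^-1)%:E.
Hypothesis nd : nondecreasing_seq (fun n : nat => 4 ^+ n * sigma lam n).
Hypothesis lim_oo : 4 ^+ n * sigma lam n @[n --> \oo] --> +oo.
Variable D : R.
Hypothesis lam_bv : forall N, \sum_(0 <= n < N) `|lam n.+1 - lam n.+2| <= D.
Implicit Types (z w : plane R).

Let s n : R := sigma lam n.
Let s0 n : 0 < s n. Proof. exact: sigma_gt0. Qed.
Let s_ge0 n : 0 <= s n. Proof. exact/ltW/s0. Qed.

Local Notation a := ((t, t) : plane R).
Local Notation Q := (nested_square lam).
Local Notation L := (lebesgue_plane R).
Let A n : R := 4 ^+ n * s n.
Let A0 n : 0 < A n. Proof. by rewrite mulr_gt0// exprn_gt0. Qed.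

Let mQ n : measurable (Q n). Proof. exact: measurable_nested_square. Qed.

Lemma zigzag_point_in_cantor_set : cantor_set lam a.
Proof.
by move=> n _; exists (zigzag2 n); [exact: size_zigzag2|exact: nested_square_center].
Qed.

Let KRe := @Re_inv_cauchy_like R.
Let KIm := @Im_inv_cauchy_like R.
Let lRe : R := limn (outer lam t mu (fun p => complex.Re p^-1)).
Let lIm : R := limn (outer lam t mu (fun p => complex.Im p^-1)).

Lemma has_principal_value_zigzag_point : has_principal_value mu a.
Proof.
exists (Complex lRe lIm).
have cRe := cvg_truncated lamC lam4 tE muE nd lim_oo lam_bv KRe.
have cIm := cvg_truncated lamC lam4 tE muE nd lim_oo lam_bv KIm.
apply/cvgrPdist_le => -[x y] /=; rewrite ltcE /= => /andP[/eqP-> x0].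
have x2 : 0 < x / 2 by rewrite divr_gt0.
move/cvgrPdist_le : cRe => /(_ _ x2) hRe; move/cvgrPdist_le : cIm => /(_ _ x2) hIm.
near=> e.
have bRe : `|lRe - complex.Re (truncated_cauchy mu a e)| <= x / 2 by near: e.
have bIm : `|lIm - complex.Im (truncated_cauchy mu a e)| <= x / 2 by near: e.
have : cmod (Complex lRe lIm - truncated_cauchy mu a e) <= x.
  apply: (le_trans (cmod_le _)); rewrite [leRHS](splitr x) lerD//.
by rewrite -lecR.
Unshelve. all: by end_near. Qed.

(** A function within [b + 2 * potential] of a constant has averages within
    [b + O(1 / A n)] of it, as the mass [4 ^- n] is small compared with [r]. *)
Lemma disc_average_le n (r b : R) (f : plane R -> R[i]) (al : R[i]) :
  0 <= b -> s n.+1 / 16 <= r < s n / 16 ->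
  (forall z, disc a r z ->
    (cmod (f z - al))%:E <= b%:E + (potential lam mu n z + potential lam mu n z))%E ->
  ((L (disc a r))^-1 * \int[L]_(z in disc a r) (cmod (f z - al))%:E
    <= (b + 160 * (64 / A n))%:E)%E.
Proof.
move=> b0 /andP[r1 r2] hf; have r0 : 0 < r by rewrite (lt_le_trans _ r1)// divr_gt0.
have [m /andP[m1 m2] mE] := lebesgue_disc a r0.
have m0 : 0 < m by rewrite (lt_le_trans _ m1)// divr_gt0// exprn_gt0.
have mD := measurable_disc a r.
have U0 z : disc a r z -> (0 <= potential lam mu n z)%E by move=> _; exact: potential_ge0.
have mU : measurable_fun (disc a r) (potential lam mu n).
  exact: (measurable_funTS (measurable_potential lam mu n)).
have IU : (\int[L]_(z in disc a r) potential lam mu n z <= (20 * r / 4 ^+ n)%:E)%E.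
  apply: (le_trans (potential_disc mu a (mQ n) r0)).
  by rewrite /nested_square /cell muE size_zigzag2 -EFinM.
have I : (\int[L]_(z in disc a r) (cmod (f z - al))%:E <=
    (b * m + (20 * r / 4 ^+ n + 20 * r / 4 ^+ n))%:E)%E.
  apply: (@le_trans _ _ (\int[L]_(z in disc a r)
      (b%:E + (potential lam mu n z + potential lam mu n z)))%E).
    by apply: ge0_le_integral_any => z zD; [rewrite lee_fin cmod_ge0|exact: hf].
  rewrite ge0_integralD//; last 2 first.
  - by move=> z zD; rewrite adde_ge0// U0.
  - exact: emeasurable_funD.
  by rewrite ge0_integralD// integral_cst// mE -EFinM !EFinD leeD// leeD.
rewrite mE inver gt_eqF//.
apply: (le_trans (lee_wpmul2l _ I)); first by rewrite lee_fin invr_ge0 ltW.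
rewrite -EFinM lee_fin mulrDr mulrCA mulVf ?gt_eqF// mulr1 lerD2l.
have p4 : 0 < 4 ^+ n :> R by rewrite exprn_gt0.
have im : m^-1 <= 4 / r ^+ 2.
  by rewrite -[leRHS]invrK lef_pV2 ?posrE ?invr_gt0 ?divr_gt0 ?exprn_gt0// invf_div.
have ir : r^-1 <= 64 / s n.
  rewrite ler_pdivlMr// mulrC ler_pdivrMr//; have := sigma_quarter lamC lam4 n.
  by rewrite -/(s n) -/(s n.+1); lra.
rewrite (_ : 160 * (64 / A n) = 160 / 4 ^+ n * (64 / s n)); last first.
  by rewrite /A; field; rewrite !gt_eqF.
apply: (@le_trans _ _ (160 / 4 ^+ n * r^-1)); last first.
  by rewrite ler_pM2l// divr_gt0.
rewrite (_ : 160 / 4 ^+ n * r^-1 = 4 / r ^+ 2 * (20 * r / 4 ^+ n + 20 * r / 4 ^+ n)).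
  by rewrite ler_wpM2r// addr_ge0// divr_ge0 ?(ltW p4)// mulr_ge0// ltW.
by field; rewrite !gt_eqF.
Qed.

Let err n : R := 128 * halving_mean (fun k => (A k)^-1) n.

Let bound n : R := (err n + `|outer lam t mu (fun p => complex.Re p^-1) n - lRe|) +
  (err n + `|outer lam t mu (fun p => complex.Im p^-1) n - lIm|).

Let err_ge0 n : 0 <= err n.
Proof.
by rewrite mulr_ge0// sumr_ge0// => k _; rewrite mulr_ge0// ?exprn_ge0// invr_ge0 ltW.
Qed.

Let bound_ge0 n : 0 <= bound n.
Proof. by rewrite /bound !addr_ge0 ?err_ge0. Qed.

Let bound_cvg0 : (fun n => bound n + 160 * (64 / A n)) @ \oo --> (0 : R).
Proof.
have iA : (fun n => (A n)^-1) @ \oo --> (0 : R) by exact: density_cvg0.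
have e0 : err @ \oo --> (0 : R).
  rewrite -(mulr0 128); apply: cvgMl_tmp; apply: halving_mean_cvg0 => // n.
  by rewrite invr_ge0 ltW.
have d0 K : cauchy_like K ->
    (fun n => `|outer lam t mu K n - limn (outer lam t mu K)|) @ \oo --> (0 : R).
  move=> KC; have c := cvg_outer lamC lam4 tE muE nd lim_oo lam_bv KC.
  rewrite -(normr0 R) -(subrr (limn (outer lam t mu K))).
  by apply: cvg_norm; apply: cvgB => //; exact: cvg_cst.
rewrite (_ : 0 = (0 + 0) + (0 + 0) + 160 * (64 * 0) :> R); last by rewrite !mulr0 !addr0.
apply: cvgD; last by do 2 apply: cvgMl_tmp.
by apply: cvgD; apply: cvgD => //; exact: d0.
Qed.

Let cauchy_near n z : disc a (s n / 16) z ->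
  ((cmod (cauchy_integral mu z - Complex lRe lIm))%:E <=
    (bound n)%:E + (potential lam mu n z + potential lam mu n z))%E.
Proof.
move=> az.
have hRe := cauchy_near_outer lamC lam4 tE muE KRe lRe az.
have hIm := cauchy_near_outer lamC lam4 tE muE KIm lIm az.
apply: (@le_trans _ _ (`|complex.Re (cauchy_integral mu z) - lRe|%:E +
    `|complex.Im (cauchy_integral mu z) - lIm|%:E)%E).
  by rewrite -EFinD lee_fin; exact: cmod_le.
by rewrite /bound EFinD addeACA; apply: leeD; [exact: hRe|exact: hIm].
Qed.

Lemma is_lebesgue_point_zigzag_point : is_lebesgue_point (cauchy_integral mu) a.
Proof.
exists (Complex lRe lIm); set F := fun r : R => (_ * _)%E.
have F0 r : (0 <= F r)%E.
  rewrite /F mule_ge0//; first by rewrite inve_ge0.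
  by apply: integral_ge0 => z _; rewrite lee_fin cmod_ge0.
have small (eps : R) : 0 < eps -> \forall r \near (0 : R)^'+, (F r <= eps%:E)%E.
  move=> eps0; have /cvgr0Pnorm_le/(_ _ eps0)[N _ hN] := bound_cvg0.
  have sN : 0 < s N / 16 by rewrite divr_gt0.
  near=> r.
  have rN : 0 < r < s N / 16.
    by apply/andP; split; near: r; [exact: nbhs_right_gt|exact: nbhs_right_lt].
  have [n [Nn sr]] := scale_of_radius lamC rN.
  apply: (@le_trans _ _ (bound n + 160 * (64 / A n))%:E).
    apply: (disc_average_le (bound_ge0 n) sr) => z az; apply: cauchy_near.
    by case/andP : sr => _ /(lt_trans az).
  by rewrite lee_fin (le_trans (ler_norm _))// hN.
apply/fine_cvgP; split.
  have := small 1 ltr01; apply: filterS => r r1.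
  by rewrite ge0_fin_numE// (le_lt_trans r1)// ltry.
apply/cvgr0Pnorm_le => eps eps0; have := small eps eps0; apply: filterS => r re.
have Ffin : F r \is a fin_num by rewrite ge0_fin_numE// (le_lt_trans re)// ltry.
by rewrite /= ger0_norm ?fine_ge0// -lee_fin fineK.
Unshelve. all: by end_near. Qed.

End conclusion.

Unset Implicit Arguments.
Set Strict Implicit.
Set Printing Implicit Defensive.

Theorem theorem5p4 (R : realType) (lam : nat -> R)
  (mu : probability (plane R) R)
  (lam_bounds : forall n : nat, (1 <= n)%N -> 0 < lam n < 2^-1)
  (lam_bv : (\sum_(1 <= n <oo) (`|lam n - lam n.+1|)%:E < +oo)%E)
  (mu_intrinsic : is_intrinsic_measure lam mu)
  (nd : nondecreasing_seq (fun n : nat => 4 ^+ n * sigma lam n))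
  (lim_oo : 4 ^+ n * sigma lam n @[n --> \oo] --> +oo) :
  (exists2 a : plane R, cantor_set lam a & has_principal_value mu a) /\
  (exists2 a : plane R, cantor_set lam a &
     is_lebesgue_point (cauchy_integral mu) a).
Proof.
have lamC : contracting lam := lam_bounds.
have lam4 n : (1 <= n)%N -> 4^-1 <= lam n.
  case: n => // n _; have := nd _ _ (leqnSn n).
  have p0 : 0 < 4 ^+ n * sigma lam n by rewrite mulr_gt0 ?exprn_gt0 ?sigma_gt0.
  rewrite (_ : 4 ^+ n.+1 * _ = 4 ^+ n * sigma lam n * (4 * lam n.+1)).
    rewrite -[leLHS]mulr1 ler_pM2l//; lra.
  by rewrite exprS sigmaS; ring.
have [_ muE] := mu_intrinsic.
have [t tE] := zigzag_point lamC.
pose D := fine (\sum_(1 <= n <oo) (`|lam n - lam n.+1|)%:E)%E.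
have bv N : \sum_(0 <= n < N) `|lam n.+1 - lam n.+2| <= D.
  have S0 : (0 <= \sum_(1 <= n <oo) (`|lam n - lam n.+1|)%:E)%E.
    by apply: nneseries_ge0.
  rewrite -lee_fin fineK ?ge0_fin_numE// -sumEFin.
  have := @nneseries_lim_ge R (fun n => (`|lam n - lam n.+1|)%:E) xpredT 1 N.+1.
  by rewrite big_add1; apply => k _ _; rewrite lee_fin.
split; exists (t, t).
- exact: zigzag_point_in_cantor_set.
- exact: (has_principal_value_zigzag_point lamC lam4 tE muE nd lim_oo bv).
- exact: zigzag_point_in_cantor_set.
- exact: (is_lebesgue_point_zigzag_point lamC lam4 tE muE nd lim_oo bv).
Qed.
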